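(* Suppose that for $\ell=1,2$ the spectral measure $F_\ell$ is absolutely continuous with respect to Lebesgue measure on $\mathbb{R}^d$ with spectral density $f_\ell$, that $\xi$ is isotropic under $\mathbb{P}_1$ and under $\mathbb{P}_2$, that $f_1$ and $f_2$ are bounded on $\mathbb{R}^d$, that the set $\{\lambda\in\mathbb{R}^d: f_1(\lambda)\ne f_2(\lambda)\}$ has positive Lebesgue measure, and that the covariance functions $c_1$ and $c_2$ are uniformly continuous on $\mathbb{R}^d\times\mathbb{R}^d$. Let $T\subset\mathbb{R}$ and let $X=\{X_t:t\in T\}$ be an $\mathbb{R}^d$-valued stochastic process on a complete probability space $(\Omega_X,\mathcal{F}_X,\mathbb{P}_X)$, with continuous sample paths and starting from the origin, i.e. $X_{t_0}(\omega_X)=0$ for all $\omega_X\in\Omega_X$, where $t_0\in T$ is the starting time. For $\omega_X\in\Omega_X$ let $X[T](\omega_X)=\{X_t(\omega_X):t\in T\}$. If $X[T]$ is unbounded $\mathbb{P}_X$-almost surely, then $$\mathbb{P}_X\big(\mathbb{P}_1\perp\mathbb{P}_2\text{ on }\sigma_{X[T]}(\xi)\big)=1 .$$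
   Context: Setting. Let $d\ge 1$. Let $\mathbb{X}$ be the set of all functions $\mathbb{R}^d\to\mathbb{R}$ with the $\sigma$-algebra generated by the cylinder sets $\{s:(s(x_1),\dots,s(x_n))\in B\}$, $n\geq 1$, $x_i\in\mathbb{R}^d$, $B\subset\mathbb{R}^n$ Borel. Let $\xi:\Omega\to\mathbb{X}$ be a measurable map on a measurable space $(\Omega,\mathcal{F})$, i.e. a real random field $\{\xi_x:x\in\mathbb{R}^d\}$. Let $\mathbb{P}_1,\mathbb{P}_2$ be probability measures on $\mathcal{F}$ under each of which every vector $(\xi_{x_1},\dots,\xi_{x_n})$ is Gaussian. For $D\subset\mathbb{R}^d$, $\sigma_D(\xi)$ is the $\sigma$-algebra generated by $\{\xi_x:x\in D\}$; for fixed $\omega_X\in\Omega_X$ this is used with $D=X[T](\omega_X)$. Standing assumptions: for $\ell=1,2$, $\xi$ has mean zero under $\mathbb{P}_\ell$; $\xi$ is stationary under $\mathbb{P}_\ell$, so its covariance function is $c_\ell(x,y)=\mathbb{E}_\ell[\xi_x\xi_y]=k_\ell(x-y)$ for some $k_\ell:\mathbb{R}^d\to\mathbb{R}$; and there is a unique finite Borel measure $F_\ell$ on $\mathbb{R}^d$ (the spectral measure) with $c_\ell(x,y)=\int_{\mathbb{R}^d}e^{i\langle\lambda,x-y\rangle}F_\ell(d\lambda)$. If $F_\ell$ is absolutely continuous with respect to Lebesgue measure, its density $f_\ell$ is called the spectral density. $\xi$ is isotropic under $\mathbb{P}_\ell$ if $k_\ell(x)$ depends only on the Euclidean norm $\lVert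 x\rVert$. $\mathbb{P}_1\perp\mathbb{P}_2$ (orthogonal) on $\sigma_D(\xi)$ means there is $A\in\sigma_D(\xi)$ with $\mathbb{P}_1(A)=0$ and $\mathbb{P}_2(A)=1$.
   Formalization: The time set T is taken to be an interval (of any kind) rather than an arbitrary subset of the reals; for T = N with a deterministic, rapidly growing sequence of sampling points and k_1(0) = k_2(0), the claim fails. *)

(* Defs.v *)
From HB Require Import structures.
From mathcomp Require Import all_boot all_order all_algebra.
From mathcomp Require Import all_classical all_reals all_analysis.
From mathcomp Require Import complex.

Set Implicit Arguments.
Unset Strict Implicit.
Unset Printing Implicit Defensive.

Import Order.TTheory GRing.Theory Num.Theory numFieldNormedType.Exports.

Local Open Scope classical_set_scope.
Local Open Scope ring_scope.

(* ['rV[R]_d] with its Borel sigma-algebra. The library equips ['rV[R]_d] with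
   a topology (max norm, equivalent to the Euclidean one) but with no
   measurable structure. *)
Notation borel_rV R d := (g_sigma_algebraType (@open 'rV[R]_d)).

Definition dotv (R : realType) (d : nat) (x y : 'rV[R]_d) : R :=
  \sum_(i < d) x ord0 i * y ord0 i.

Definition enorm (R : realType) (d : nat) (x : 'rV[R]_d) : R :=
  Num.sqrt (\sum_(i < d) x ord0 i ^+ 2).

Section lebesgue_tuple.
Variable R : realType.
Local Open Scope ereal_scope.

Definition cons_pair n (p : measurableTypeR R * n.-tuple (measurableTypeR R)) :
    n.+1.-tuple (measurableTypeR R) := [the n.+1.-tuple _ of p.1 :: p.2].

Lemma measurable_cons_pair n : measurable_fun [set: _] (@cons_pair n).
Proof. exact: measurable_cons. Qed.

Section step.
Variables (n : nat)
  (m : {sigma_finite_measure set (n.-tuple (measurableTypeR R)) -> \bar R}).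

Definition lebesgue_cons : set (n.+1.-tuple (measurableTypeR R)) -> \bar R :=
  pushforward (@lebesgue_measure R \x m) (@cons_pair n).

Let lebesgue_cons0 : lebesgue_cons set0 = 0.
Proof. by rewrite /lebesgue_cons /pushforward preimage_set0 measure0. Qed.

Let lebesgue_cons_ge0 A : 0 <= lebesgue_cons A.
Proof. exact: (measure_ge0 (@lebesgue_measure R \x m)). Qed.

Let lebesgue_cons_sigma_additive : semi_sigma_additive lebesgue_cons.
Proof.
apply: (@measure_semi_sigma_additive _ _ _
  (pushforward (@lebesgue_measure R \x m) (@cons_pair n))).
exact: measurable_cons_pair.
Qed.

HB.instance Definition _ := isMeasure.Build _ _ _ lebesgue_cons
  lebesgue_cons0 lebesgue_cons_ge0 lebesgue_cons_sigma_additive.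

Let lebesgue_cons_sigma_finite : sigma_finite setT lebesgue_cons.
Proof.
have /sigma_finiteP[F [TF ndF Foo]] := sigma_finiteT (@lebesgue_measure R).
have /sigma_finiteP[G [TG ndG Goo]] := sigma_finiteT m.
pose h (t : n.+1.-tuple (measurableTypeR R)) :
    measurableTypeR R * n.-tuple (measurableTypeR R) :=
  (thead t, [tuple of behead t]).
have mh : measurable_fun setT h.
  apply/measurable_fun_pair => /=; first exact: measurable_tnth.
  exact: measurable_behead.
exists (fun k => h @^-1` (F k `*` G k)).
  apply/esym/seteqP; split=> // t _.
  have [i _ Fi] : (\bigcup_i F i) (thead t) by rewrite -TF.
  have [j _ Gj] : (\bigcup_i G i) [tuple of behead t] by rewrite -TG.
  exists (maxn i j) => //; split => /=.
    by move: Fi; apply/subsetPset/ndF; rewrite leq_maxl.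
  by move: Gj; apply/subsetPset/ndG; rewrite leq_maxr.
move=> k; have [mFk Fkoo] := Foo k; have [mGk Gkoo] := Goo k.
split.
  by rewrite -[X in measurable X]setTI; apply: mh => //; exact: measurableX.
rewrite /lebesgue_cons /pushforward -comp_preimage.
rewrite (_ : h \o @cons_pair n = id); last first.
  apply/funext => -[x t]; rewrite /h /cons_pair /=; congr pair.
  exact/val_inj.
rewrite preimage_id product_measure1E//.
by rewrite lte_mul_pinfty// ge0_fin_numE.
Qed.

HB.instance Definition _ :=
  Measure_isSigmaFinite.Build _ _ _ lebesgue_cons lebesgue_cons_sigma_finite.

End step.

Fixpoint lebesgue_tuple n :
    {sigma_finite_measure set (n.-tuple (measurableTypeR R)) -> \bar R} :=
  match n return
    {sigma_finite_measure set (n.-tuple (measurableTypeR R)) -> \bar R} with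
  | 0 => \d_([tuple] : 0.-tuple (measurableTypeR R))
  | n'.+1 => lebesgue_cons (lebesgue_tuple n')
  end.

End lebesgue_tuple.

Lemma lebesgue_tuple_box (R : realType) n
    (A : 'I_n -> set (measurableTypeR R)) :
  (forall i, measurable (A i)) ->
  lebesgue_tuple R n [set t | forall i, A i (tnth t i)] =
  (\big[mule/1]_(i < n) lebesgue_measure (A i))%E.
Proof.
elim: n A => [|n ih] A mA.
  by rewrite big_ord0 /= diracE mem_set// => -[].
rewrite big_ord_recl -ih//= /lebesgue_cons /pushforward.
rewrite -product_measure1E//; last first.
  rewrite (_ : [set _ | _] = \bigcap_(i in [set: 'I_n])
      (@tnth n (measurableTypeR R) ^~ i @^-1` A (lift ord0 i))).
    apply: fin_bigcap_measurable => // i _.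
    by rewrite -[X in measurable X]setTI; exact: measurable_tnth.
  by apply/seteqP; split=> t /= At i; [move=> _|]; exact: At.
have consS x t j : tnth (@cons_pair R n (x, t)) (lift ord0 j) = tnth t j.
  by rewrite !(tnth_nth 0).
congr product_measure1; apply/seteqP; split=> -[x t] /=.
  move=> At; split; first exact: (At ord0).
  by move=> i; rewrite /= -(consS x); exact: (At (lift ord0 i)).
move=> [Ax At] i; case: (unliftP ord0 i) => [j|] ->; last exact: Ax.
by rewrite consS; exact: At.
Qed.

Section lebesgue_rV.
Variables (R : realType) (d : nat).

Definition rV_of_tuple (t : d.-tuple (measurableTypeR R)) : borel_rV R d :=
  \row_(i < d) tnth t i.

Lemma measurable_rV_of_tuple : measurable_fun [set: _] rV_of_tuple.
Proof.
apply: (@measurability _ _ _ (borel_rV R d) _ _ (@open 'rV[R]_d)) => //.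
move=> _ [U oU <-]; rewrite setTI.
pose box (c : {ffun 'I_d -> rat}) (k : nat) : set 'rV[R]_d :=
  [set x | forall i, `|x ord0 i - ratr (c i)| < k.+1%:R^-1].
pose I := [set ck : {ffun 'I_d -> rat} * nat | box ck.1 ck.2 `<=` U].
have -> : U = \bigcup_(ck in I) box ck.1 ck.2.
  apply/seteqP; split; last by move=> x [ck Ick]; exact: Ick.
  move=> x Ux.
  have /nbhs_ballP[e /= e0 xeU] : nbhs x U by exact: open_nbhs_nbhs.
  pose k := Num.truncn (2 / e).
  have ke : 2 * k.+1%:R^-1 < e.
    by rewrite ltr_pdivrMr// mulrC -ltr_pdivrMr// truncnS_gt.
  have /choice[c cP] : forall i, exists q : rat,
      `|x ord0 i - ratr q| < k.+1%:R^-1.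
    move=> i.
    have [q] := @rat_in_itvoo R (x ord0 i - k.+1%:R^-1) (x ord0 i + k.+1%:R^-1)
      ltac:(by rewrite ltrBlDr -addrA ltrDl addr_gt0// invr_gt0).
    rewrite in_itv/= => /andP[q1 q2]; exists q.
    by rewrite distrC ltr_distl q1.
  exists ([ffun i => c i], k) => /=; last by move=> i; rewrite ffunE.
  move=> y /= yb; apply: xeU; split => // i j; rewrite ord1.
  apply: lt_trans ke; rewrite /ball/= (_ : x 0 j - y 0 j =
    (x 0 j - ratr (c j)) - (y 0 j - ratr (c j))); last first.
    by rewrite opprB addrA subrK.
  rewrite (le_lt_trans (ler_normB _ _))// mulr_natl mulr2n ltrD//.
  by have := yb j; rewrite ffunE.
rewrite preimage_bigcup bigcup_mkcond.
apply: countable_bigcupT_measurable => //.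
move=> [c k] /=; case: ifPn => // _.
rewrite (_ : _ @^-1` _ = \bigcap_(i in [set: 'I_d])
    ((fun t => @tnth d (measurableTypeR R) t i) @^-1`
      ball (ratr (c i) : R) k.+1%:R^-1)).
  apply: fin_bigcap_measurable => //.
  move=> i _; rewrite -[X in measurable X]setTI; apply: measurable_tnth => //.
  exact: measurable_realfun.measurable_ball.
apply/seteqP; split=> t /= tb i.
  by move=> _; have := tb i; rewrite mxE /ball/= distrC.
by have := tb i Logic.I; rewrite mxE /ball/= distrC.
Qed.

Definition lebesgue_rV : set (borel_rV R d) -> \bar R :=
  pushforward (@lebesgue_tuple R d) rV_of_tuple.

Let lebesgue_rV0 : lebesgue_rV set0 = 0%E.
Proof. by rewrite /lebesgue_rV /pushforward preimage_set0 measure0. Qed.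

Let lebesgue_rV_ge0 A : (0 <= lebesgue_rV A)%E.
Proof. exact: (measure_ge0 (@lebesgue_tuple R d)). Qed.

Let lebesgue_rV_sigma_additive : semi_sigma_additive lebesgue_rV.
Proof.
apply: (@measure_semi_sigma_additive _ _ _
  (pushforward (@lebesgue_tuple R d) rV_of_tuple)).
exact: measurable_rV_of_tuple.
Qed.

HB.instance Definition _ := isMeasure.Build _ _ _ lebesgue_rV
  lebesgue_rV0 lebesgue_rV_ge0 lebesgue_rV_sigma_additive.

Lemma lebesgue_rV_box (A : 'I_d -> set (measurableTypeR R)) :
  (forall i, measurable (A i)) ->
  lebesgue_rV [set x | forall i, A i (x ord0 i)] =
  (\big[mule/1]_(i < d) lebesgue_measure (A i))%E.
Proof.
move=> mA; rewrite -lebesgue_tuple_box// /lebesgue_rV /pushforward.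
congr (lebesgue_tuple R d _); apply/seteqP; split=> t /= At i;
  by have := At i; rewrite mxE.
Qed.

End lebesgue_rV.

Section random_field.
Variables (R : realType) (d : nat).

Definition cylinder : set (set ('rV[R]_d -> R)) :=
  [set C | exists (n : nat) (x : 'I_n.+1 -> 'rV[R]_d)
             (B : set (borel_rV R n.+1)),
     measurable B /\ C = [set s | B (\row_(i < n.+1) s (x i))] ].

(* Possibly degenerate one-dimensional Gaussian laws. The point masses are
   listed separately because [normal_prob m 0] is the uniform law on [0, 1]. *)
Definition gaussian_law (mu : set (measurableTypeR R) -> \bar R) : Prop :=
  (exists m s : R, 0 < s /\
     forall A, measurable A -> mu A = normal_prob m s A) \/
  (exists m : R, forall A, measurable A -> mu A = \d_m A).

Variables (dO : measure_display) (Omega : measurableType dO).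
Implicit Types (P : probability Omega R) (xi : Omega -> 'rV[R]_d -> R).

Definition gaussian_vector P (n : nat) (V : Omega -> 'rV[R]_n) : Prop :=
  forall a : 'rV[R]_n,
    gaussian_law (pushforward P
      (fun w => dotv a (V w) : measurableTypeR R)).

Definition gaussian_field P xi : Prop :=
  forall (n : nat) (x : 'I_n -> 'rV[R]_d),
    gaussian_vector P (fun w => \row_(i < n) xi w (x i)).

Definition mean_zero P xi : Prop :=
  forall x, ('E_P[fun w => xi w x] = 0)%E.

(* [fine] loses nothing here: second moments of a Gaussian field are finite. *)
Definition covariance_fun P xi (x y : 'rV[R]_d) : R :=
  fine ('E_P[fun w => (xi w x * xi w y)%R])%E.

Definition stationary_with P xi (k : 'rV[R]_d -> R) : Prop :=
  forall x y, covariance_fun P xi x y = k (x - y).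

Definition isotropic (k : 'rV[R]_d -> R) : Prop :=
  forall x y, enorm x = enorm y -> k x = k y.

Definition sigma_field xi (D : set 'rV[R]_d) : set (set Omega) :=
  <<s \bigcup_(x in D) preimage_set_system [set: Omega] (fun w => xi w x)
        (@measurable _ (measurableTypeR R)) >>.

Definition orthogonal_on (S : set (set Omega)) (P1 P2 : probability Omega R) :
    Prop :=
  exists2 A, S A & P1 A = 0%E /\ P2 A = 1%E.

End random_field.

Notation field_space R d := (g_sigma_algebraType (@cylinder R d)).

Section spectral.
Variables (R : realType) (d : nat).
Local Open Scope complex_scope.

Definition expi (t : R) : R[i] := cos t +i* sin t.

Definition complex_integral (mu : {measure set (borel_rV R d) -> \bar R})
    (g : borel_rV R d -> R[i]) : R[i] :=
  (\int[mu]_l complex.Re (g l)) +i* (\int[mu]_l complex.Im (g l)).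

Definition spectral_representation (c : 'rV[R]_d -> 'rV[R]_d -> R)
    (F : {measure set (borel_rV R d) -> \bar R}) : Prop :=
  forall x y, (c x y)%:C = complex_integral F (fun l => expi (dotv l (x - y))).

Definition is_spectral_measure (c : 'rV[R]_d -> 'rV[R]_d -> R)
    (F : {finite_measure set (borel_rV R d) -> \bar R}) : Prop :=
  spectral_representation c F /\
  forall G : {finite_measure set (borel_rV R d) -> \bar R},
    spectral_representation c G -> forall A, measurable A -> G A = F A.

Definition is_density (F : set (borel_rV R d) -> \bar R)
    (f : borel_rV R d -> R) : Prop :=
  [/\ measurable_fun [set: borel_rV R d] f, (forall l, 0 <= f l) &
      forall A, measurable A ->
        F A = (\int[@lebesgue_rV R d]_(l in A) (f l)%:E)%E].

End spectral.

(* Main.v *)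
(* The spectral densities differ, so the covariances differ, and some z satisfies
   k1 0 + k1 z <> k2 0 + k2 z.  The range of a path is connected and unbounded,
   so by the intermediate value theorem it contains pairs (x_i, y_i) with
   |x_i - y_i| = |z| (Euclidean norm) that are arbitrarily far from each other.
   By isotropy the sums U_i = xi_(x_i) + xi_(y_i) have variance 2 (k 0 + k z);
   by the Riemann-Lebesgue lemma they are almost uncorrelated, and Gaussianity
   gives Cov (U_i^2, U_j^2) = 2 Cov (U_i, U_j)^2.  Hence the
   empirical means of the U_i^2 concentrate at two distinct values under P1 and
   P2, and the Borel-Cantelli lemma turns this into a separating event.

   The Riemann-Lebesgue lemma is obtained from the boundedness of the density by
   near-orthogonality: on a large box, far apart cosines are almost orthogonal
   in L^2, so their signed averages have small L^2 norm, which bounds the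
   average of the |k (x_i)|. *)
Require Import Defs.
From HB Require Import structures.
From mathcomp Require Import all_boot all_order all_algebra.
From mathcomp Require Import all_classical all_reals all_analysis.
From mathcomp Require Import measurable_realfun ring lra.
Import Order.TTheory GRing.Theory Num.Theory numFieldNormedType.Exports.
Local Open Scope classical_set_scope.
Local Open Scope ring_scope.
Set Implicit Arguments.
Unset Strict Implicit.
Unset Printing Implicit Defensive.

(** * Moments of the normal law *)

(** A single observation reveals only [k 0], on which the two models may agree; a sum over two
    points is the simplest linear statistic whose variance also sees [k z]. The path cannot be
    steered: the intermediate value theorem fixes the length of the difference of a pair but not its
    direction, and isotropy makes the length enough. The decay of [k] comes without a rate, so the
    variance bound for a mean of [N.+1] squares is of order v^2 / N + eta^2, with [eta] a uniform
    bound on the covariances of distinct pairs. The second term does not shrink with [N]; hence the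
    pairs are chosen anew for every tolerance, and only the resulting events are combined.
    Boundedness of a density enters as [F A <= M * lebd A]: an L^2 estimate under Lebesgue measure
    on a box then controls integrals under [F]. Gaussian vectors are defined through the laws of
    their linear combinations, so mixed fourth moments have to be recovered from one-dimensional
    ones; this is why the moments of the normal law up to order four come first. *)

Section normal_moments.
Context {R : realType}.
Local Notation leb := (@lebesgue_measure R).

Lemma integral_is_derive (F f : R -> R) (a b : R) : a < b ->
  (forall x, is_derive x (1:R) F (f x)) -> continuous f ->
  (\int[leb]_(x in `[a, b]) (f x)%:E = (F b - F a)%:E)%E.
Proof.
move=> ab dF cf; rewrite EFinB; apply: continuous_FTC2 => //.
- exact: continuous_subspaceT.
- have cF x : F y @[y --> x] --> F x.
    exact/differentiable_continuous/derivable1_diffP.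
  split=> //; first exact/cvg_at_right_filter/cF.
  exact/cvg_at_left_filter/cF.
- by move=> x _; rewrite derive1E; exact: derive_val.
Qed.

(** Fundamental theorem of calculus on the windows of radius [n.+1] about [m], then dominated
    convergence with [|f|] as the bound; the boundary terms vanish in the limit by assumption. *)
Lemma integral_derive_vanishing (F f : R -> R) (m : R) :
  (forall x, is_derive x (1:R) F (f x)) -> continuous f ->
  leb.-integrable setT (EFin \o f) ->
  F (m + n.+1%:R) @[n --> \oo] --> 0 -> F (m - n.+1%:R) @[n --> \oo] --> 0 ->
  (\int[leb]_x (f x)%:E = 0)%E.
Proof.
move=> dF cf intf Fy FNy.
pose I (n : nat) := [set` `[m - n.+1%:R, m + n.+1%:R]].
pose g n := (EFin \o f) \_ (I n).
have mf := measurable_int _ intf.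
have [_ _ +] : [/\ leb.-integrable setT (EFin \o f),
    [sequence \int[leb]_x `|g n x - (EFin \o f) x|]_n @ \oo --> 0 &
    [sequence \int[leb]_x g n x]_n @ \oo --> \int[leb]_x (EFin \o f) x]%E.
  apply: (@dominated_convergence _ _ _ leb setT measurableT g (EFin \o f)
    (abse \o (EFin \o f))) => //.
  - move=> n; have mI : measurable (I n) by exact: measurable_itv.
    by apply: (measurable_restrictT (EFin \o f) mI).1; exact: measurable_funTS.
  - apply: aeW => x _ /=; apply: cvg_near_cst.
    near=> n; rewrite /g patchE mem_set// /I/= in_itv/=.
    rewrite -ler_distl.
    apply: (@le_trans _ _ n%:R); last by rewrite ler_nat.
    by near: n; exact: nbhs_infty_ger.
  - exact: integrable_abse.
  - apply: aeW => x n _; rewrite /g patchE; case: ifPn => //= _.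
    by rewrite normr0 lee_fin.
rewrite (_ : [sequence _]_n = EFin \o (fun n => F (m + n.+1%:R) - F (m - n.+1%:R))).
  move=> h; apply: (cvg_unique _ h) => //.
  apply: cvg_EFin; first exact: nearW.
  by have := cvgB Fy FNy; rewrite subrr; apply.
apply/funext => n /=; rewrite /g -integral_mkcond.
rewrite (@integral_is_derive F f)//.
rewrite ltrD2l (@lt_trans _ _ 0)// oppr_lt0//.
Unshelve. all: by end_near. Qed.

Variables (m s : R) (s0 : 0 < s).
Local Notation g := (normal_pdf m s).

Lemma is_derive_normal_pdf (x : R) :
  is_derive x (1:R) g (- ((x - m) * g x / s ^+ 2)).
Proof.
have sn0 : s != 0 by rewrite gt_eqF.
rewrite normal_pdfE// /normal_fun.
apply: is_derive_eq.
rewrite /GRing.scale /=; field.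
by [].
Qed.


(** With t = (x - m)^2 / (2 s^2) the two densities are multiples of e^(-t) and e^(-t/4), which
    leaves a factor e^(3t/4) to spare; it beats the fourth power 4 s^4 t^2. This one bound serves
    both the integrability of the moments and the decay of the boundary terms. *)
Lemma normal_pdf_le_double_sd : exists2 C, 0 <= C & forall x k, (k <= 4)%N ->
  `|x - m| ^+ k * g x <= C * normal_pdf m (2 * s) x.
Proof.
have sn0 : s != 0 by rewrite gt_eqF.
have s2n0 : 2 * s != 0 by rewrite mulf_neq0.
pose Q := normal_peak (2 * s); pose P := normal_peak s.
have Q0 : 0 < Q by exact: normal_peak_gt0.
have P0 : 0 < P by exact: normal_peak_gt0.
exists ((1 + 16 * s ^+ 4) * P / Q).
  by rewrite divr_ge0 ?mulr_ge0 ?addr_ge0 ?mulr_ge0 ?exprn_ge0 ?(ltW P0) ?(ltW Q0) ?(ltW s0).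
move=> x k k4; rewrite !normal_pdfE// -/P -/Q.
pose t := (x - m) ^+ 2 / (s ^+ 2 *+ 2).
have t0 : 0 <= t by rewrite divr_ge0 ?sqr_ge0// mulrn_wge0 ?sqr_ge0.
have -> : normal_fun m s x = expR (- t) by rewrite /normal_fun mulNr.
have -> : normal_fun m (2 * s) x = expR (- t) * expR (3 / 4 * t).
  rewrite -expRD /normal_fun /t; congr expR; field; by [].
have -> : (1 + 16 * s ^+ 4) * P / Q * (Q * (expR (- t) * expR (3 / 4 * t))) =
  ((1 + 16 * s ^+ 4) * expR (3 / 4 * t)) * (P * expR (- t)).
  by field; rewrite gt_eqF.
apply: ler_wpM2r; first by rewrite mulr_ge0 ?expR_ge0// ltW.
have u0 : 0 <= 3 / 4 * t by rewrite mulr_ge0.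
apply: (@le_trans _ _ (1 + `|x - m| ^+ 4)).
  have [y1|y1] := leP `|x - m| 1.
    by rewrite (@le_trans _ _ 1) ?exprn_ile1 ?lerDl ?exprn_ge0.
  by rewrite (@le_trans _ _ (`|x - m| ^+ 4)) ?lerDr ?ler_weXn2l// ltW.
have := @expR_ge1Dxn R (3 / 4 * t) 1 u0.
have -> : `|x - m| ^+ 4 = 4 * s ^+ 4 * t ^+ 2.
  rewrite -[X in _ ^+ X]/(2 * 2)%N exprM real_normK ?num_real// /t; field; by [].
rewrite (_ : 2`! = 2)//; set e := expR _ => le_e.
have s4 : 0 <= s ^+ 4 by rewrite exprn_ge0// ltW.
have t2 : 0 <= t ^+ 2 by rewrite sqr_ge0.
have st : 0 <= s ^+ 4 * t ^+ 2 by rewrite mulr_ge0.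
(* The quadratic Taylor term of the exponential is 9/32 t^2, and 16 * 9/32 >= 4. *)
apply: (@le_trans _ _ ((1 + 16 * s ^+ 4) * (1 + (3 / 4 * t) ^+ 2 / 2))).
  by nra.
by rewrite ler_wpM2l// addr_ge0// mulr_ge0.
Qed.

Lemma integrable_normal_moment k : (k <= 4)%N ->
  leb.-integrable setT (fun x => ((x - m) ^+ k * g x)%:E).
Proof.
move=> k4; have [C C0 hC] := normal_pdf_le_double_sd.
apply: (@le_integrable _ _ _ leb setT measurableT _
  (fun x => (C * normal_pdf m (2 * s) x)%:E)).
- apply/measurable_EFinP; apply: measurable_funM; last exact: measurable_normal_pdf.
  by apply: measurable_funX; exact: measurable_funB.
- move=> x _ /=; rewrite lee_fin normrM normrX (ger0_norm (normal_pdf_ge0 _ _ _)).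
  by rewrite (le_trans (hC x k k4))// ler_norm.
- apply: (@integrableZl _ _ _ leb setT measurableT C
    (fun x => (normal_pdf m (2 * s) x)%:E)).
  exact: integrable_normal_pdf.
Qed.

Definition normal_moment k := \int[leb]_x ((x - m) ^+ k * g x).

(** Integration by parts: the derivative of [(x - m) ^+ k * g x] combines the moments of orders
    [k.-1] and [k.+1] and has integral 0. At [k = 0] the truncated [k.-1] is harmless because of the
    factor [k%:R]. *)
Lemma normal_momentS k : (k <= 3)%N ->
  normal_moment k.+1 = s ^+ 2 * k%:R * normal_moment k.-1.
Proof.
move=> k3; have sn0 : s != 0 by rewrite gt_eqF.
pose F x := (x - m) ^+ k * g x.
pose f x := k%:R * ((x - m) ^+ k.-1 * g x) - s ^- 2 * ((x - m) ^+ k.+1 * g x).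
have dF x : is_derive x (1:R) F (f x).
  have dg := is_derive_normal_pdf x.
  have d1 : is_derive x (1:R) (fun x => x - m) 1.
    by apply: is_derive_eq; rewrite oppr0 addr0.
  have -> : F = (fun x => x - m) ^+ k * g.
    by apply/funext => y; rewrite /F [in RHS]fctE /= exprfctE.
  have dX := @is_deriveX R _ (fun x => x - m) k x 1 1 d1.
  have dM := is_deriveM dX dg.
  apply: is_derive_eq.
  rewrite exprfctE /f (exprS _ k) /GRing.scale /=.
  set u := (x - m) ^+ k; set v := (x - m) ^+ k.-1.
  by field.
have int k' : (k' <= 4)%N -> leb.-integrable setT (EFin \o (fun x => (x - m) ^+ k' * g x)).
  exact: integrable_normal_moment.
have i1 := int k.-1 (leq_trans (leq_pred _) (leqW k3)).
have i2 := int k.+1 k3.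
have if1 : leb.-integrable setT (EFin \o (fun x => k%:R * ((x - m) ^+ k.-1 * g x))).
  exact: (integrableZl measurableT k%:R i1).
have if2 : leb.-integrable setT (EFin \o (fun x => s ^- 2 * ((x - m) ^+ k.+1 * g x))).
  exact: (integrableZl measurableT (s ^- 2) i2).
have intf : leb.-integrable setT (EFin \o f).
  exact: (integrableB measurableT if1 if2).
have cy j : continuous (fun x => (x - m) ^+ j * g x).
  move=> x; apply: cvgM; last exact: continuous_normal_pdf.
  apply: (cvg_comp (fun x => x - m) (fun y => y ^+ j)); last exact: exprn_continuous.
  by apply: (@cvgB _ R^o) => //; exact: cvg_cst.
have cf : continuous f.
  by move=> x; apply: cvgB; (apply: cvgM; [exact: cvg_cst|exact: cy]).
have [C C0 hC] := normal_pdf_le_double_sd.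
pose D := C * normal_peak (2 * s).
(* One spare factor [|x - m|] shows F = O(1 / |x - m|), so the boundary terms vanish; the sign [e]
   below treats both ends at once. *)
have bF x : `|x - m| * `|F x| <= D.
  rewrite /F normrM normrX mulrA -exprS (ger0_norm (normal_pdf_ge0 _ _ _)).
  rewrite (le_trans (hC x k.+1 k3))// ler_wpM2l// normal_pdf_ub//.
  by rewrite mulf_neq0.
have vanish (e : R) : `|e| = 1 -> F (m + e * n.+1%:R) @[n --> \oo] --> 0.
  move=> e1; apply/norm_cvg0P.
  apply: (@squeeze_cvgr _ _ _ _ (cst 0) (fun n => D * n.+1%:R^-1)).
  - apply: nearW => n; rewrite normr_ge0/= ler_pdivlMr// mulrC.
    have := bF (m + e * n.+1%:R); rewrite (addrC m) addrK normrM e1 mul1r.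
    by rewrite ger0_norm.
  - exact: cvg_cst.
  - rewrite -[X in _ --> X](mulr0 D); apply: cvgM; first exact: cvg_cst.
    exact: cvg_harmonic.
have I0 : (\int[leb]_x (f x)%:E = 0)%E.
  apply: (integral_derive_vanishing dF cf intf (m := m)).
    by have := vanish 1; rewrite normr1 => /(_ erefl); under eq_fun do rewrite mul1r.
  by have := vanish (-1); rewrite normrN1 => /(_ erefl); under eq_fun do rewrite mulN1r.
have : \int[leb]_x f x = 0 by rewrite /Rintegral I0.
rewrite /f RintegralB// !RintegralZl// => /subr0_eq h.
rewrite -mulrA h /normal_moment; field; by [].
Qed.

Lemma normal_moment0 : normal_moment 0 = 1.
Proof.
rewrite /normal_moment; under eq_Rintegral do rewrite expr0 mul1r.
by rewrite /Rintegral integral_normal_pdf.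
Qed.

Lemma normal_moment1 : normal_moment 1 = 0.
Proof. by rewrite normal_momentS// mulr0 mul0r. Qed.

Lemma normal_moment2 : normal_moment 2 = s ^+ 2.
Proof. by rewrite normal_momentS//= normal_moment0 !mulr1. Qed.

Lemma normal_moment4 : normal_moment 4 = 3 * s ^+ 4.
Proof. by rewrite normal_momentS//= normal_moment2; ring. Qed.

End normal_moments.

Section normal_prob_integral.
Context {R : realType} (m s : R).
Local Notation leb := (@lebesgue_measure R).
Local Notation g := (normal_pdf m s).

(** The Radon-Nikodym derivative and [normal_pdf] have the same integral over every measurable set,
    so they agree almost everywhere and can be exchanged under the integral. *)
Lemma ge0_integral_normal_prob (f : R -> \bar R) : measurable_fun setT f ->
  (forall x, 0 <= f x)%E ->
  (\int[normal_prob m s]_x f x = \int[leb]_x (f x * (g x)%:E))%E.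
Proof.
move=> mf f0; have dom := normal_prob_dominates m s.
have mg : measurable_fun setT (fun x => (g x)%:E).
  by apply/measurable_EFinP; exact: measurable_normal_pdf.
pose nu : {finite_measure set _ -> \bar R} := normal_prob m s.
pose h := Radon_Nikodym_SigmaFinite.f nu leb.
have inth : leb.-integrable setT h.
  exact: Radon_Nikodym_SigmaFinite.f_integrable.
rewrite -(Radon_Nikodym_SigmaFinite.change_of_variables dom)//.
apply: ae_eq_integral => //.
- by apply: emeasurable_funM => //; exact: measurable_int inth.
- exact: emeasurable_funM.
- apply: ae_eqe_mul2l; apply: integral_ae_eq => // E _ mE.
  by rewrite -Radon_Nikodym_SigmaFinite.f_integral.
Qed.

Lemma integral_normal_prob (f : R -> R) : measurable_fun setT f ->
  leb.-integrable setT (fun x => (f x * g x)%:E) ->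
  (normal_prob m s).-integrable setT (EFin \o f) /\
  \int[normal_prob m s]_x f x = \int[leb]_x (f x * g x).
Proof.
move=> mf intfg; have dom := normal_prob_dominates m s.
have mg : measurable_fun setT (fun x => (g x)%:E).
  by apply/measurable_EFinP; exact: measurable_normal_pdf.
have mfE : measurable_fun setT (EFin \o f) by exact/measurable_EFinP.
have intf : (normal_prob m s).-integrable setT (EFin \o f).
  apply/integrableP; split => //.
  rewrite ge0_integral_normal_prob//; last exact: measurableT_comp.
  move/integrableP : intfg => [_]; apply: le_lt_trans.
  rewrite le_eqVlt; apply/predU1P; left; apply: eq_integral => x _ /=.
  by rewrite -EFinM normrM (ger0_norm (normal_pdf_ge0 _ _ _)).
split => //; congr fine.
have mP := measurable_funepos mfE; have mN := measurable_funeneg mfE.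
rewrite integralE 2?ge0_integral_normal_prob//.
rewrite [RHS]integralE; congr (_ - _)%E; apply: eq_integral => x _.
- have g0 : (0 <= (g x)%:E)%E by rewrite lee_fin normal_pdf_ge0.
  by rewrite !funeposE EFinM maxe_pMl// mul0e.
- have g0 : (0 <= (g x)%:E)%E by rewrite lee_fin normal_pdf_ge0.
  by rewrite !funenegE EFinM maxe_pMl// mul0e mulNe.
Qed.

End normal_prob_integral.

Section gaussian_moments.
Context {R : realType} {d : measure_display} {T : measurableType d}.
Variable P : probability T R.

Lemma integral_law (U : T -> measurableTypeR R)
    (nu : {measure set (measurableTypeR R) -> \bar R}) (f : R -> R) :
  measurable_fun setT U -> measurable_fun setT f ->
  (forall A, measurable A -> pushforward P U A = nu A) ->
  nu.-integrable setT (EFin \o f) ->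
  P.-integrable setT (EFin \o (f \o U)) /\
  \int[P]_w f (U w) = \int[nu]_x f x.
Proof.
move=> mU mf PU intf.
have mfE : measurable_fun setT (EFin \o f) by exact/measurable_EFinP.
have intU : P.-integrable setT (EFin \o (f \o U)).
  apply/integrableP; split.
    by apply/measurable_EFinP; exact: measurableT_comp.
  move/integrableP : intf => [_]; apply: le_lt_trans.
  rewrite (eq_measure_integral (pushforward P U) (m1 := nu)); last first.
    by move=> A mA _; rewrite -PU.
  rewrite ge0_integral_pushforward//; exact: measurableT_comp.
split => //; congr fine.
rewrite (eq_measure_integral (pushforward P U) (m1 := nu)); last first.
  by move=> A mA _; rewrite -PU.
by rewrite integral_pushforward.
Qed.

(** The zero mean forces the parameter [m] of the law to be 0, after which central moments are plain
    moments: 3 s^4 = 3 (s^2)^2 for a normal law, while both sides vanish for a point mass. *)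
Lemma gaussian_law_moment4 (U : T -> measurableTypeR R) :
  measurable_fun setT U -> gaussian_law (pushforward P U) ->
  (\int[P]_w (U w)%:E = 0)%E ->
  P.-integrable setT (fun w => (U w ^+ 4)%:E) /\
  \int[P]_w (U w ^+ 4) = 3 * (\int[P]_w (U w ^+ 2)) ^+ 2.
Proof.
move=> mU gU EU.
have mX (a : R) k : measurable_fun setT (fun x : R => (x - a) ^+ k).
  by apply: measurable_funX; exact: measurable_funB.
(* Integrability is available for the centred variable only, hence the detour through
   [U w - a + a]. *)
have mean0 (a : R) : \int[P]_w (U w - a) = 0 ->
    P.-integrable setT (EFin \o (fun w => U w - a)) -> a = 0.
  move=> Ua intUa.
  have inta : P.-integrable setT (EFin \o (fun=> a)) by exact: finite_measure_integrable_cst.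
  have : \int[P]_w (U w - a + a) = 0.
    by under eq_Rintegral do rewrite subrK; rewrite /Rintegral EU.
  by rewrite RintegralD// Ua Rintegral_cst//= probability_setT mulr1 add0r.
case: gU => [[m [s [s0 PU]]]|[m PU]].
- have int k (k4 : (k <= 4)%N) := integral_law mU (mX m k) PU
    (@integral_normal_prob _ m s _ (mX m k) (integrable_normal_moment m s0 k4)).1.
  have val k (k4 : (k <= 4)%N) : \int[P]_w (U w - m) ^+ k = normal_moment m s k.
    rewrite (int k k4).2.
    by have [_ ->] := @integral_normal_prob _ m s _ (mX m k) (integrable_normal_moment m s0 k4).
  have m0 : m = 0.
    apply: mean0; first by have := val 1%N isT; rewrite normal_moment1.
    exact: (int 1%N isT).1.
  move: int val; rewrite m0 => int val.
  have U0 k w : (U w - 0) ^+ k = U w ^+ k by rewrite subr0.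
  split.
    have := (int 4%N isT).1; rewrite (_ : _ \o _ = fun w => (U w ^+ 4)%:E)//.
    by apply/funext => w /=; rewrite subr0.
  have := val 2%N isT; under eq_Rintegral do rewrite U0; move=> ->.
  have := val 4%N isT; under eq_Rintegral do rewrite U0; move=> ->.
  by rewrite normal_moment2// normal_moment4//; ring.
- pose nu : {measure set (measurableTypeR R) -> \bar R} := \d_(m : measurableTypeR R).
  have mXE k : measurable_fun [set: measurableTypeR R] (EFin \o (fun x : R => (x - m) ^+ k)).
    by have /measurable_EFinP := mX m k.
  have int k : nu.-integrable setT (EFin \o (fun x : R => (x - m) ^+ k)).
    apply/integrableP; split; first exact: mXE.
    rewrite integral_dirac//; last by apply: measurableT_comp => //; exact: mXE.
    by rewrite diracT mul1e ltry.
  have int2 k := @integral_law U nu _ mU (mX m k) PU (int k).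
  have val k : \int[P]_w (U w - m) ^+ k.+1 = 0.
    rewrite (int2 k.+1).2 /Rintegral integral_dirac//; last exact: mXE.
    by rewrite diracT mul1e /= subrr expr0n.
  have m0 : m = 0 by apply: mean0; [exact: (val 0%N)|exact: (int2 1%N).1].
  move: int2 val; rewrite m0 => int2 val.
  have U0 k w : (U w - 0) ^+ k = U w ^+ k by rewrite subr0.
  split.
    have := (int2 4%N).1; rewrite (_ : _ \o _ = fun w => (U w ^+ 4)%:E)//.
    by apply/funext => w /=; rewrite subr0.
  have := val 1%N; under eq_Rintegral do rewrite U0; move=> ->.
  have := val 3%N; under eq_Rintegral do rewrite U0; move=> ->.
  by rewrite expr0n mulr0.
Qed.

End gaussian_moments.

(** * Fourth moments of Gaussian fields *)

Section rV_borel.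
Context {R : realType}.

Lemma continuous_measurable_borel_rV d (f : 'rV[R]_d -> R) : continuous f ->
  measurable_fun setT (f : borel_rV R d -> measurableTypeR R).
Proof.
move=> cf; apply: (measurability _ (RGenOpens.measurableE R)) => //.
move=> _ [_ [a [b ->]] <-]; rewrite setTI.
apply: sub_sigma_algebra; apply: open_comp => // x _; exact: cf.
Qed.

Lemma measurable_coord d (i : 'I_d) :
  measurable_fun setT ((fun l => l ord0 i) : borel_rV R d -> measurableTypeR R).
Proof.
by apply: (@continuous_measurable_borel_rV d (fun l => l ord0 i)); exact: coord_continuous.
Qed.

End rV_borel.

Section linearity.
Context {R : realType} {d : measure_display} {T : measurableType d}.
Variables (mu : {measure set T -> \bar R}) (D : set T) (mD : measurable D).
Implicit Types (f g : T -> R).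

Local Notation integr f := (mu.-integrable D (EFin \o f)).

Lemma integrable_dominated f g : measurable_fun D f -> integr g ->
  (forall w, `|f w| <= g w) -> integr f.
Proof.
move=> mf ig fg; apply: (le_integrable mD _ _ ig).
  exact/measurable_EFinP.
by move=> w _ /=; rewrite lee_fin (le_trans (fg w))// ler_norm.
Qed.

Lemma integrable_lin f g (a b : R) : integr f -> integr g ->
  integr (fun w => a * f w + b * g w).
Proof.
move=> iF iG; apply: (integrableD mD
  (f := EFin \o (fun w => a * f w)) (g := EFin \o (fun w => b * g w))).
  exact: (integrableZl mD a iF).
exact: (integrableZl mD b iG).
Qed.

Lemma Rintegral_lin f g (a b : R) : integr f -> integr g ->
  \int[mu]_(w in D) (a * f w + b * g w) =
  a * \int[mu]_(w in D) f w + b * \int[mu]_(w in D) g w.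
Proof.
move=> iF iG; rewrite RintegralD ?RintegralZl//.
  exact: (integrableZl mD a iF).
exact: (integrableZl mD b iG).
Qed.

Lemma integrable_Rsum (I : Type) (s : seq I) (f : I -> T -> R) :
  (forall i, integr (f i)) -> integr (fun w => \sum_(i <- s) f i w).
Proof.
move=> intf; have := @integrable_sum _ _ _ mu D mD I s xpredT _ (fun i _ => intf i).
by congr (mu.-integrable D _); apply/funext => w /=; rewrite sumEFin.
Qed.

Lemma Rintegral_sum (I : Type) (s : seq I) (f : I -> T -> R) :
  (forall i, integr (f i)) ->
  \int[mu]_(w in D) (\sum_(i <- s) f i w) = \sum_(i <- s) \int[mu]_(w in D) f i w.
Proof.
move=> intf; elim: s => [|i s ih].
  under eq_Rintegral do rewrite big_nil.
  by rewrite big_nil /Rintegral integral0.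
under eq_Rintegral do rewrite big_cons.
by rewrite RintegralD// ?ih ?big_cons//; exact: integrable_Rsum.
Qed.

End linearity.

Section fourth_moments.
Context {R : realType} {d : measure_display} {T : measurableType d}.
Variable P : probability T R.
Implicit Types (f g U V W : T -> R).

Local Notation integr f := (P.-integrable setT (EFin \o f)).

Lemma integrable_prob_cst (a : R) : integr (fun=> a).
Proof. exact: finite_measure_integrable_cst. Qed.

Lemma sqr_le1_pow4 (x : R) : x ^+ 2 <= 1 + x ^+ 4.
Proof. have := sqr_ge0 (x ^+ 2 - 1); nra. Qed.

Section integrability.
Variables (U V : T -> R).
Hypotheses (mU : measurable_fun setT U) (mV : measurable_fun setT V).
Hypotheses (U4 : integr (fun w => U w ^+ 4)) (V4 : integr (fun w => V w ^+ 4)).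

Lemma integrable_sqr_pow4 : integr (fun w => U w ^+ 2).
Proof.
have h := integrable_lin measurableT 1 1 (integrable_prob_cst 1) U4.
apply: (integrable_dominated measurableT _ h); first exact: measurable_funX.
by move=> w; rewrite ger0_norm ?sqr_ge0// mul1r mul1r sqr_le1_pow4.
Qed.

Lemma integrable_pow4 : integr U.
Proof.
have h := integrable_lin measurableT 1 1 (integrable_prob_cst 1) integrable_sqr_pow4.
apply: (integrable_dominated measurableT _ h) => // w.
rewrite !mul1r -real_normK ?num_real//.
have := normr_ge0 (U w); set u := `|U w|; nra.
Qed.

Lemma integrable_sqrM : integr (fun w => U w ^+ 2 * V w ^+ 2).
Proof.
have h := integrable_lin measurableT 1 1 U4 V4.
apply: (integrable_dominated measurableT _ h).
  by apply: measurable_funM; exact: measurable_funX.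
move=> w; rewrite !mul1r ger0_norm; last by rewrite mulr_ge0 ?sqr_ge0.
by have := sqr_ge0 (U w ^+ 2 - V w ^+ 2); nra.
Qed.

End integrability.

Lemma integrable_mul U V : measurable_fun setT U -> measurable_fun setT V ->
  integr (fun w => U w ^+ 4) -> integr (fun w => V w ^+ 4) ->
  integr (fun w => U w * V w).
Proof.
move=> mU mV U4 V4.
have h := integrable_lin measurableT 1 1 (integrable_sqr_pow4 mU U4) (integrable_sqr_pow4 mV V4).
apply: (integrable_dominated measurableT _ h); first exact: measurable_funM.
move=> w; rewrite !mul1r normrM -(real_normK (num_real (U w))) -(real_normK (num_real (V w))).
by have := sqr_ge0 (`|U w| - `|V w|); have := mulr_ge0 (normr_ge0 (U w)) (normr_ge0 (V w)); nra.
Qed.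

(** This relation is all that the variance computations retain of Gaussianity. It holds for every
    linear combination of field values, degenerate ones included. *)
Definition gaussian_fourth W :=
  integr (fun w => W w ^+ 4) /\
  \int[P]_w (W w ^+ 4) = 3 * (\int[P]_w (W w ^+ 2)) ^+ 2.

(* Polarization of the fourth moment:
   [12 U^2 V^2 = (U + V)^4 + (U - V)^4 - 2 U^4 - 2 V^4]. *)
Lemma gaussian_sqr_cov U V :
  measurable_fun setT U -> measurable_fun setT V ->
  gaussian_fourth U -> gaussian_fourth V ->
  gaussian_fourth (fun w => U w + V w) -> gaussian_fourth (fun w => U w - V w) ->
  \int[P]_w (U w ^+ 2 * V w ^+ 2) =
  \int[P]_w (U w ^+ 2) * \int[P]_w (V w ^+ 2) + 2 * (\int[P]_w (U w * V w)) ^+ 2.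
Proof.
move=> mU mV [U4 EU4] [V4 EV4] [D4 ED4] [B4 EB4].
have U2 := integrable_sqr_pow4 mU U4; have V2 := integrable_sqr_pow4 mV V4.
have UV := integrable_mul mU mV U4 V4.
have UUVV := integrable_lin measurableT 1 1 U2 V2.
have sqrD (e : R) : e ^+ 2 = 1 -> \int[P]_w ((U w + e * V w) ^+ 2) =
    \int[P]_w (U w ^+ 2) + \int[P]_w (V w ^+ 2) + 2 * e * \int[P]_w (U w * V w).
  move=> e1; under eq_Rintegral => w _.
    rewrite (_ : _ ^+ 2 = 1 * (1 * U w ^+ 2 + 1 * V w ^+ 2) + (2 * e) * (U w * V w)); last first.
      by rewrite sqrrD exprMn e1; ring.
    over.
  by rewrite (Rintegral_lin measurableT _ _ UUVV UV) (Rintegral_lin measurableT _ _ U2 V2) !mul1r.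
have E1 : \int[P]_w ((U w + V w) ^+ 2) =
    \int[P]_w (U w ^+ 2) + \int[P]_w (V w ^+ 2) + 2 * \int[P]_w (U w * V w).
  have := sqrD 1 (expr1n _ _); under eq_Rintegral do rewrite mul1r.
  by rewrite mulr1.
have E2 : \int[P]_w ((U w - V w) ^+ 2) =
    \int[P]_w (U w ^+ 2) + \int[P]_w (V w ^+ 2) - 2 * \int[P]_w (U w * V w).
  have := sqrD (-1); rewrite sqrrN expr1n => /(_ erefl).
  by under eq_Rintegral do rewrite mulN1r; move=> ->; ring.
have D := integrable_lin measurableT 1 1 D4 B4; have S := integrable_lin measurableT 1 1 U4 V4.
have -> : \int[P]_w (U w ^+ 2 * V w ^+ 2) =
  12^-1 * (1 * \int[P]_w ((U w + V w) ^+ 4) + 1 * \int[P]_w ((U w - V w) ^+ 4)) +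
  - 6^-1 * (1 * \int[P]_w (U w ^+ 4) + 1 * \int[P]_w (V w ^+ 4)).
  rewrite -(Rintegral_lin measurableT _ _ D4 B4) -(Rintegral_lin measurableT _ _ U4 V4) -(Rintegral_lin measurableT _ _ D S).
  by apply: eq_Rintegral => w _; field.
by rewrite ED4 EB4 EU4 EV4 E1 E2; field.
Qed.

End fourth_moments.

Section field_moments.
Context {R : realType} {n : nat} {d : measure_display} {T : measurableType d}.
Variables (P : probability T R) (xi : T -> 'rV[R]_n -> R).
Hypothesis mxi : measurable_fun [set: T] (xi : T -> field_space R n).

Lemma measurable_field_at (x : 'rV[R]_n) :
  measurable_fun setT (fun w => xi w x : measurableTypeR R).
Proof.
move=> _ A mA; rewrite setTI.
pose B : set (borel_rV R 1) := (fun l => l ord0 ord0) @^-1` A.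
have mB : measurable B by rewrite -[B]setTI; exact: measurable_coord.
have : measurable (xi @^-1` [set s | B (\row_(i < 1) s x)]).
  rewrite -[X in measurable X]setTI; apply: mxi => //.
  (* The index [0] stands for one observation point, since cylinders are built on [n.+1] points. *)
  by apply: sub_sigma_algebra; exists 0%N, (fun=> x), B.
congr measurable; apply/seteqP; split => w; by rewrite /B /= mxE.
Qed.

Hypotheses (gxi : gaussian_field P xi) (xi0 : mean_zero P xi).

Lemma gaussian_field_comb k (x : 'I_k -> 'rV[R]_n) (a : 'I_k -> R) :
  gaussian_law (pushforward P
    (fun w => \sum_(i < k) a i * xi w (x i) : measurableTypeR R)).
Proof.
have := gxi x (\row_i a i); congr (gaussian_law (pushforward P _)).
by apply/funext => w; apply: eq_bigr => i _; rewrite !mxE.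
Qed.

(** Treated before general combinations because it supplies the integrability needed to compute
    their mean term by term. *)
Lemma field_fourth (x : 'rV[R]_n) : gaussian_fourth P (xi ^~ x).
Proof.
apply: gaussian_law_moment4; first exact: measurable_field_at.
  have := @gaussian_field_comb 1 (fun=> x) (fun=> 1).
  congr (gaussian_law (pushforward P _)).
  by apply/funext => w; rewrite big_ord1 mul1r.
by have := xi0 x; rewrite unlock.
Qed.

Lemma field_comb_fourth k (x : 'I_k -> 'rV[R]_n) (a : 'I_k -> R) :
  gaussian_fourth P (fun w => \sum_(i < k) a i * xi w (x i)).
Proof.
have ixi (y : 'rV[R]_n) : P.-integrable setT (EFin \o (xi ^~ y)).
  by apply: integrable_pow4; [exact: measurable_field_at|have [] := field_fourth y].
apply: gaussian_law_moment4; last 1 first.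
- under eq_integral do rewrite -sumEFin.
  rewrite integral_sum//; last first.
    by move=> i; exact: (integrableZl measurableT (a i) (ixi (x i))).
  rewrite big1// => i _; under eq_integral do rewrite EFinM.
  rewrite (integralZl measurableT (ixi (x i)))/=.
  by have := xi0 (x i); rewrite unlock => ->; rewrite mule0.
- apply: measurable_sum => i; apply: measurable_funM => //; exact: measurable_field_at.
- exact: gaussian_field_comb.
Qed.

End field_moments.

(** * Concentration and separation *)

Section weak_law.
Context {R : realType} {d : measure_display} {T : measurableType d}.
Variables (P : probability T R) (N : nat) (U : 'I_N.+1 -> T -> R).
Hypothesis mU : forall i, measurable_fun setT (U i).
Hypothesis gU : forall i, gaussian_fourth P (U i).
Hypothesis gD : forall i j, gaussian_fourth P (fun w => U i w + U j w).
Hypothesis gB : forall i j, gaussian_fourth P (fun w => U i w - U j w).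
Variables (v eta : R).
Hypothesis varU : forall i, \int[P]_w (U i w ^+ 2) = v.
Hypothesis covU : forall i j, i != j -> `|\int[P]_w (U i w * U j w)| <= eta.

Definition mean_sqr w : R := N.+1%:R^-1 * \sum_(i < N.+1) U i w ^+ 2.

Lemma measurable_mean_sqr : measurable_fun setT mean_sqr.
Proof.
apply: measurable_funM => //; apply: measurable_sum => i; exact: measurable_funX.
Qed.

Let dev (ij : 'I_N.+1 * 'I_N.+1) w := (U ij.1 w ^+ 2 - v) * (U ij.2 w ^+ 2 - v).

(** Expanding the product, the v^2 part of E[U_i^2 U_j^2] cancels and twice the squared covariance
    remains. The diagonal is included, which is why [gD] and [gB] range over equal indices as
    well. *)
Let dev_cov ij : P.-integrable setT (EFin \o dev ij) /\
  \int[P]_w dev ij w = 2 * (\int[P]_w (U ij.1 w * U ij.2 w)) ^+ 2.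
Proof.
case: ij => i j; rewrite /dev /=.
have Ui := integrable_sqr_pow4 (mU i) (gU i).1.
have Uj := integrable_sqr_pow4 (mU j) (gU j).1.
have UU := integrable_sqrM (mU i) (mU j) (gU i).1 (gU j).1.
have c1 := integrable_prob_cst P 1.
have I1 := integrable_lin measurableT (- v) (- v) Ui Uj.
have I2 := integrable_lin measurableT 1 1 I1 UU.
have I3 := integrable_lin measurableT 1 (v ^+ 2) I2 c1.
have devE w : (U i w ^+ 2 - v) * (U j w ^+ 2 - v) =
  1 * (1 * (- v * U i w ^+ 2 + - v * U j w ^+ 2) + 1 * (U i w ^+ 2 * U j w ^+ 2)) + v ^+ 2 * 1.
  by ring.
split.
  by move: I3; congr (P.-integrable setT _); apply/funext => w /=; rewrite devE.
under eq_Rintegral do rewrite devE.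
rewrite (Rintegral_lin measurableT _ _ I2 c1) (Rintegral_lin measurableT _ _ I1 UU) (Rintegral_lin measurableT _ _ Ui Uj).
rewrite gaussian_sqr_cov// !varU Rintegral_cst//.
have -> : fine (P setT) = 1 by rewrite probability_setT.
ring.
Qed.

Let devE w : (mean_sqr w - v) ^+ 2 = N.+1%:R ^- 2 * \sum_ij dev ij w.
Proof.
have -> : mean_sqr w - v = N.+1%:R^-1 * \sum_(i < N.+1) (U i w ^+ 2 - v).
  rewrite sumrB sumr_const card_ord mulrBr /mean_sqr; congr (_ - _).
  by rewrite -[v *+ _]mulr_natl mulrA mulVf ?mul1r// pnatr_eq0.
rewrite exprMn exprVn; congr (_ * _).
by rewrite expr2 big_distrlr/= pair_big.
Qed.

Lemma mean_sqr_variance :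
  P.-integrable setT (EFin \o (fun w => (mean_sqr w - v) ^+ 2)) /\
  \int[P]_w ((mean_sqr w - v) ^+ 2) <= 2 * v ^+ 2 / N.+1%:R + 2 * eta ^+ 2.
Proof.
have isum := @integrable_Rsum _ _ _ P _ measurableT _ (index_enum _) dev (fun ij => (dev_cov ij).1).
split.
  have := integrableZl measurableT (N.+1%:R ^- 2) isum.
  congr (P.-integrable setT _); apply/funext => w /=.
  by rewrite devE EFinM.
under eq_Rintegral do rewrite devE.
rewrite RintegralZl// (Rintegral_sum measurableT); last by move=> ij; exact: (dev_cov ij).1.
apply: (@le_trans _ _ (N.+1%:R ^- 2 *
    \sum_(ij : 'I_N.+1 * 'I_N.+1) ((ij.1 == ij.2)%:R * (2 * v ^+ 2) + 2 * eta ^+ 2))).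
  rewrite ler_wpM2l ?invr_ge0 ?exprn_ge0//; apply: ler_sum => -[i j] _ /=.
  rewrite (dev_cov _).2 /=; have [->|ij] := eqVneq i j.
    under eq_Rintegral do rewrite -expr2.
    by rewrite varU mul1r lerDl mulr_ge0 ?sqr_ge0.
  rewrite mul0r add0r ler_wpM2l// -(real_normK (num_real _)).
  apply: lerXn2r; rewrite ?nnegrE//; last exact: covU.
  (* Nonnegativity of [eta] comes from [covU] itself at this off-diagonal pair. *)
  exact: le_trans (normr_ge0 _) (covU ij).
rewrite -(pair_big xpredT xpredT (fun i j : 'I_N.+1 => (i == j)%:R * (2 * v ^+ 2) + 2 * eta ^+ 2))/=.
rewrite (eq_bigr (fun=> 2 * v ^+ 2 + N.+1%:R * (2 * eta ^+ 2))); last first.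
  move=> i _; rewrite big_split/= sumr_const card_ord -[_ *+ N.+1]mulr_natl; congr (_ + _).
  rewrite (bigD1 i)//= eqxx mul1r big1 ?addr0// => j ji.
  by rewrite eq_sym (negbTE ji) mul0r.
rewrite sumr_const card_ord -mulr_natl le_eqVlt; apply/predU1P; left.
by field; rewrite addrC natr1 pnatr_eq0.
Qed.

Lemma mean_sqr_chebyshev (delta : R) : 0 < delta ->
  (P [set w | (delta <= `|mean_sqr w - v|)%R] <=
   ((2 * v ^+ 2 / N.+1%:R + 2 * eta ^+ 2) / delta ^+ 2)%:E)%E.
Proof.
move=> d0; set A := [set w | _].
have mS := measurable_mean_sqr.
have mA : measurable A.
  have mf : measurable_fun setT (fun w => `|mean_sqr w - v|).
    by apply: measurableT_comp => //; exact: measurable_funB.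
  rewrite (_ : A = (fun w => `|mean_sqr w - v|) @^-1` `[delta, +oo[).
    by rewrite -[X in measurable X]setTI; exact: mf.
  by apply/seteqP; split => w; rewrite /A /= in_itv/= andbT.
have [iS le] := mean_sqr_variance.
have PA : P A \is a fin_num by exact: fin_num_measure.
rewrite -(fineK PA) lee_fin ler_pdivlMr ?exprn_gt0//; apply: le_trans le.
have iA : P.-integrable setT (EFin \o (fun w => \1_A w)).
  by apply: integrable_indic => //; rewrite -ge0_fin_numE.
have -> : fine (P A) = \int[P]_w (\1_A w).
  by rewrite /Rintegral integral_indic// setIT.
rewrite mulrC -RintegralZl//; apply: le_Rintegral => //.
  exact: (integrableZl measurableT (delta ^+ 2) iA).
move=> w _; rewrite indicE; have [|] := boolP (w \in A).
  rewrite inE /A /= mulr1 -[(mean_sqr w - v) ^+ 2]real_normK ?num_real// => dw.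
  by rewrite ler_sqr// nnegrE ltW.
by rewrite mulr0 sqr_ge0.
Qed.

End weak_law.

Section orthogonality.
Context {R : realType} {d : measure_display} {T : measurableType d}.
Variables (P1 P2 : probability T R) (G : set (set T)).
Hypothesis mG : <<s G >> `<=` (@measurable _ T).

(** With the summable tolerances 2^-(n+1), the limsup of the events is null under [P1]. Its
    complement is the liminf of the complements, hence lies in their limsup, which is null under
    [P2] for the same reason. Countable operations keep the event in the generated sigma-algebra. *)
Lemma orthogonal_of_separating :
  (forall e : R, 0 < e -> exists A, [/\ <<s G >> A, (P1 A <= e%:E)%E & (P2 (~` A) <= e%:E)%E]) ->
  orthogonal_on <<s G >> P1 P2.
Proof.
move=> sep.
have e0 n : 0 < 1 / (2 ^ n.+1)%:R :> R by rewrite divr_gt0// ltr0n expn_gt0.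
have /choice[A hA] : forall n, exists A, [/\ <<s G >> A,
   (P1 A <= (1 / (2 ^ n.+1)%:R)%:E)%E & (P2 (~` A) <= (1 / (2 ^ n.+1)%:R)%:E)%E].
  by move=> n; exact: sep.
have GA n : <<s G >> (A n) by case: (hA n).
have mA n : measurable (A n) by exact: mG.
have null (P : probability T R) (B : (set T)^nat) : (forall n, measurable (B n)) ->
    (forall n, P (B n) <= (1 / (2 ^ n.+1)%:R)%:E)%E -> P (lim_sup_set B) = 0%E.
  move=> mB leB; apply: lim_sup_set_cvg0 => //.
  apply: (@le_lt_trans _ _ (\sum_(n <oo) (1 / (2 ^ n.+1)%:R : R)%:E)%E).
    by apply: lee_nneseries => // n _; exact: leB.
  by apply: (le_lt_trans (epsilon_trick0 xpredT ler01)); rewrite ltry.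
have Glim : <<s G >> (lim_sup_set A).
  apply: (@bigcap_measurable _ (g_sigma_algebraType G)) => // n _.
  by apply: bigcup_measurable => k _; exact: GA.
exists (lim_sup_set A) => //; split.
  by apply: null => // n; case: (hA n).
have mlim : measurable (lim_sup_set A) by exact: mG.
have P2C : P2 (~` lim_sup_set A) = 0%E.
  apply/eqP; rewrite eq_le measure_ge0 andbT.
  have <- : P2 (lim_sup_set (fun n => ~` A n)) = 0%E.
    apply: null => n; [exact: measurableC|by case: (hA n)].
  apply: le_measure; rewrite ?inE//; first exact: measurableC.
    apply: bigcapT_measurable => n; apply: bigcup_measurable => k _.
    exact: measurableC.
  move=> w; rewrite /lim_sup_set /= => nw n _.
  have : exists m, ~ (\bigcup_(j >= m) A j) w.
    apply: contrapT => h; apply: nw => m _.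
    by apply: contrapT => h'; apply: h; exists m.
  move=> [m hm]; exists (maxn m n); first by rewrite /= leq_maxr.
  by move=> Aw; apply: hm; exists (maxn m n); rewrite //= leq_maxl.
have := probability_setC P2 mlim; rewrite P2C => /esym/eqP.
rewrite sube_eq ?add0e// => /eqP <- //.
Qed.

End orthogonality.

(** * The Riemann-Lebesgue lemma for bounded densities *)

Section box_cosine.
Context {R : realType} (r : R) (r0 : 0 < r).
Local Notation leb := (@lebesgue_measure R).
Local Notation I := [set` `[- r, r]].

Lemma sym_itv_measure : leb I = (2 * r)%:E.
Proof.
by rewrite lebesgue_measure_itv/= lte_fin gtrN// -EFinB; congr EFin; ring.
Qed.

(** The Fourier transform of the indicator of [-r, r], with its continuous value at 0. *)
Definition itv_cos (y : R) : R := if y == 0 then 2 * r else 2 * sin (r * y) / y.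

(** The sine part cancels by symmetry of the interval. The phase [a] is carried along because, when
    one coordinate of a box is integrated out, the other coordinates act as a phase. *)
Lemma integral_itv_cos (y a : R) :
  (\int[leb]_(u in I) (cos (u * y + a))%:E = (cos a * itv_cos y)%:E)%E.
Proof.
have rr : - r < r by exact: gtrN.
rewrite /itv_cos; have [->|y0] := eqVneq y 0.
  under eq_integral do rewrite mulr0 add0r.
  by rewrite integral_cst// [X in (_ * X)%E]sym_itv_measure -EFinM.
have dF (x : R) : is_derive x (1:R) (fun u => sin (u * y + a) / y) (cos (x * y + a)).
  apply: is_derive_eq.
  by rewrite /GRing.scale /=; field.
rewrite (integral_is_derive rr dF).
  by congr EFin; rewrite mulNr !sinD cosN sinN; field.
move=> x; apply: (cvg_comp (fun u => u * y + a) cos); last exact: continuous_cos.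
  by apply: (@cvgD _ R^o); [apply: cvgM => //; exact: cvg_cst|exact: cvg_cst].
Qed.

Lemma measurable_cos_phase d (T : measurableType d) (p : T -> R) (D : set T) :
  measurable_fun D p -> measurable_fun D (fun t => cos (p t)).
Proof.
move=> mp; apply: measurableT_comp => //.
by apply: continuous_measurable_fun; exact: continuous_cos.
Qed.

Lemma integrable_cos d (T : measurableType d) (mu : {measure set T -> \bar R})
    (D : set T) (p : T -> R) : measurable D -> (mu D < +oo)%E ->
  measurable_fun setT p -> mu.-integrable D (fun t => (cos (p t))%:E).
Proof.
move=> mD Dfin mp; apply: measurable_bounded_integrable => //.
  by apply: measurable_cos_phase; exact: measurable_funTS.
by exists 1; split => // x x1 t _ /=; rewrite (le_trans (cos_max _))// ltW.
Qed.

(** Read off the integral form: a cosine is at most 1 in absolute value on an interval of length 2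
    r. *)
Lemma itv_cos_le (y : R) : `|itv_cos y| <= 2 * r.
Proof.
have mI := sym_itv_measure.
have mp : measurable_fun setT (fun u : R => u * y + 0) by apply: measurable_funD => //; exact: measurable_funM.
have int1 : leb.-integrable I (fun u => (cos (u * y + 0))%:E).
  by apply: integrable_cos => //=; rewrite [X in (X < _)%E]mI ltry.
have -> : itv_cos y = \int[leb]_(u in I) cos (u * y + 0).
  by rewrite /Rintegral integral_itv_cos /= cos0 mul1r.
apply: (le_trans (le_normr_Rintegral _ int1)) => //.
rewrite (_ : 2 * r = \int[leb]_(u in I) (1 : R)); last first.
  by rewrite Rintegral_cst// [X in fine X]mI /= mul1r.
apply: le_Rintegral => //.
- exact: integrable_norm int1.
- have : leb.-integrable I (fun=> (cos (0 : R))%:E).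
    by apply: integrable_cos => //=; rewrite [X in (X < _)%E]mI ltry.
  by rewrite cos0.
- by move=> x _; exact: cos_max.
Qed.

Lemma itv_cos_decay (y : R) : 0 < `|y| -> `|itv_cos y| <= 2 / `|y|.
Proof.
rewrite normr_gt0 /itv_cos => y0; rewrite (negbTE y0) normrM normfV normrM normr_nat.
by rewrite ler_pM2r ?invr_gt0 ?normr_gt0// ger_pMr// sin_max.
Qed.

Definition tuple_box n : set (n.-tuple (measurableTypeR R)) :=
  [set t | forall i, [set` `[- r, r]] (tnth t i)].

Arguments tuple_box : clear implicits.

Lemma measurable_tuple_box n : measurable (tuple_box n).
Proof.
rewrite (_ : tuple_box n = \bigcap_(i in [set: 'I_n])
    ((fun t => @tnth n (measurableTypeR R) t i) @^-1` [set` `[- r, r]])).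
  apply: fin_bigcap_measurable => // i _.
  by rewrite -[X in measurable X]setTI; apply: measurable_tnth.
by apply/seteqP; split=> t /= tb i; [move=> _|]; exact: tb.
Qed.

Lemma tuple_box_measure n : lebesgue_tuple R n (tuple_box n) = ((2 * r) ^+ n)%:E.
Proof.
have mI := sym_itv_measure.
have := @lebesgue_tuple_box R n (fun=> I) (fun=> measurable_itv _).
rewrite -[[set t | _]]/(tuple_box n) => ->.
rewrite (eq_bigr (fun=> (2 * r)%:E)); last by move=> i _; exact: mI.
by rewrite prodEFin prodr_const card_ord.
Qed.

Definition tuple_phase n (x : 'I_n -> R) (a : R) (t : n.-tuple (measurableTypeR R)) : R :=
  \sum_(i < n) x i * tnth t i + a.

Lemma measurable_tuple_phase n (x : 'I_n -> R) a : measurable_fun setT (tuple_phase x a).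
Proof.
apply: measurable_funD => //; apply: measurable_sum => i.
by apply: measurable_funM => //; exact: measurable_tnth.
Qed.

(** Fubini, one coordinate per induction step: integrating out the head yields the factor
    [itv_cos (x ord0)] times a cosine of the same shape in the remaining coordinates. *)
Lemma integral_tuple_box_cos n (x : 'I_n -> R) (a : R) :
  (\int[lebesgue_tuple R n]_(t in tuple_box n) (cos (tuple_phase x a t))%:E =
   (cos a * \prod_(i < n) itv_cos (x i))%:E)%E.
Proof.
elim: n x a => [|n ih] x a.
  have mf : measurable_fun (tuple_box 0) (fun t => (cos (tuple_phase x a t))%:E).
    apply/measurable_EFinP/measurable_cos_phase/measurable_funTS.
    exact: measurable_tuple_phase.
  rewrite /= integral_dirac//; last exact: measurable_tuple_box.
  rewrite diracE mem_set/=; last by case.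
  by rewrite mul1e /tuple_phase !big_ord0 add0r mulr1.
have mphi := @measurable_cons_pair R n.
pose m := lebesgue_tuple R n.
pose D := I `*` tuple_box n.
have DE : @cons_pair R n @^-1` tuple_box n.+1 = D.
  apply/seteqP; split => -[u t] /=.
    move=> h; split; first exact: (h ord0).
    move=> i; have := h (lift ord0 i); rewrite !(tnth_nth 0)//.
  move=> [hu ht] i; case: (unliftP ord0 i) => [j|] ->; last exact: hu.
  by have := ht j; rewrite !(tnth_nth 0).
have mD : measurable D by apply: measurableX => //; exact: measurable_tuple_box.
have mI := sym_itv_measure.
have muD : ((leb \x m) D < +oo)%E.
  rewrite product_measure1E//; last exact: measurable_tuple_box.
  by rewrite [X in (X * _)%E]mI [X in (_ * X)%E]tuple_box_measure -EFinM ltry.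
have mphase : measurable_fun setT (tuple_phase x a \o @cons_pair R n).
  by apply: measurableT_comp => //; exact: measurable_tuple_phase.
pose f (p : measurableTypeR R * n.-tuple (measurableTypeR R)) : \bar R :=
  (cos (tuple_phase x a (cons_pair p)))%:E.
have intf : (leb \x m)%E.-integrable D f by exact: integrable_cos.
have -> : (\int[lebesgue_tuple R n.+1]_(t in tuple_box n.+1) (cos (tuple_phase x a t))%:E =
    \int[leb \x m]_(p in D) f p)%E.
  rewrite -[in RHS]DE.
  rewrite -(@integral_pushforward _ _ _ _ _ _ mphi (leb \x m)%E (tuple_box n.+1)
    (fun t => (cos (tuple_phase x a t))%:E))//.
  - apply/measurable_EFinP/measurable_cos_phase; exact: measurable_tuple_phase.
  - by rewrite DE.
  - exact: measurable_tuple_box.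
(* Fubini is applied on the whole product space, so the box moves into the integrand as a
   restriction. *)
rewrite integral_mkcond -integral21_prod_meas1; last first.
  by apply: (integrable_mkcond f mD).1.
transitivity (\int[m]_(t in tuple_box n)
    ((cos (tuple_phase (fun i => x (lift ord0 i)) a t))%:E * (itv_cos (x ord0))%:E))%E.
  rewrite [RHS]integral_mkcond; apply: eq_integral => t _.
  rewrite /fubini_G patchE; case: ifPn => ht.
    rewrite -EFinM -integral_itv_cos [RHS]integral_mkcond.
    apply: eq_integral => u _; rewrite !patchE.
    have -> : ((u, t) \in D) = (u \in I).
      apply/idP/idP => [/set_mem[hu _]|/set_mem hu]; apply/mem_set => //.
      by split => //; exact: set_mem ht.
    case: ifPn => // _; rewrite /f /tuple_phase big_ord_recl /=; congr (cos _)%:E.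
    rewrite addrA mulrC; congr (_ * _ + _ + _).
    by apply: eq_bigr => i _; rewrite !(tnth_nth 0).
  apply: integral0_eq => u _; rewrite patchE; case: ifPn => //.
  by rewrite inE => -[_ h]; move: ht; rewrite notin_setE.
rewrite integralZr//; last 2 first.
- exact: measurable_tuple_box.
- apply: integrable_cos; first exact: measurable_tuple_box.
    by rewrite [X in (X < _)%E](tuple_box_measure n) ltry.
  exact: measurable_tuple_phase.
by rewrite ih -EFinM big_ord_recl; congr EFin; ring.
Qed.

End box_cosine.
Arguments tuple_box {R} r n.

Section rV_box.
Context {R : realType} {d : nat} (r : R) (r0 : 0 < r).
Local Notation lebd := (@lebesgue_rV R d).

Definition rV_box : set (borel_rV R d) := [set l | forall i, [set` `[- r, r]] (l ord0 i)].

Lemma measurable_rV_box : measurable rV_box.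
Proof.
rewrite (_ : rV_box = \bigcap_(i in [set: 'I_d])
    ((fun l : borel_rV R d => l ord0 i) @^-1` [set` `[- r, r]])).
  apply: fin_bigcap_measurable => // i _.
  by rewrite -[X in measurable X]setTI; apply: measurable_coord.
by apply/seteqP; split=> t /= tb i; [move=> _|]; exact: tb.
Qed.

Lemma preimage_rV_box : @rV_of_tuple R d @^-1` rV_box = tuple_box r d.
Proof. by apply/seteqP; split => t /= h i; have := h i; rewrite mxE. Qed.

Lemma lebesgue_rV_boxE : lebd rV_box = ((2 * r) ^+ d)%:E.
Proof. by rewrite /lebesgue_rV /pushforward preimage_rV_box tuple_box_measure. Qed.

Lemma measurable_dotv (z : 'rV[R]_d) :
  measurable_fun setT (fun l : borel_rV R d => dotv l z).
Proof.
by apply: measurable_sum => i; apply: measurable_funM => //; exact: measurable_coord.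
Qed.

Lemma integrable_box_cos (z : 'rV[R]_d) :
  lebd.-integrable rV_box (fun l => (cos (dotv l z))%:E).
Proof.
apply: integrable_cos; [exact: measurable_rV_box| |exact: measurable_dotv].
by rewrite [X in (X < _)%E]lebesgue_rV_boxE ltry.
Qed.

Lemma Rintegral_box_cos (z : 'rV[R]_d) :
  \int[lebd]_(l in rV_box) cos (dotv l z) = \prod_(i < d) itv_cos r (z ord0 i).
Proof.
have mphi := @measurable_rV_of_tuple R d.
have := @integral_pushforward _ _ _ _ _ _ mphi (lebesgue_tuple R d) rV_box
    (fun l => (cos (dotv l z))%:E).
rewrite preimage_rV_box => H.
rewrite /Rintegral -[X in fine X]/(\int[pushforward (lebesgue_tuple R d) (@rV_of_tuple R d)]_(l in rV_box) (cos (dotv l z))%:E)%E.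
have phE t : dotv (rV_of_tuple t) z = tuple_phase (fun i => z ord0 i) 0 t.
  by rewrite /dotv /tuple_phase addr0; apply: eq_bigr => i _; rewrite mxE mulrC.
rewrite H.
- rewrite (eq_integral (fun t => (cos (tuple_phase (fun i => z ord0 i) 0 t))%:E)).
    by rewrite integral_tuple_box_cos//= cos0 mul1r.
  by move=> t _ /=; rewrite phE.
- by apply/measurable_EFinP/measurable_cos_phase; exact: measurable_dotv.
- apply: integrable_cos; first exact: measurable_tuple_box.
    by rewrite [X in (X < _)%E]tuple_box_measure// ltry.
  by apply: (measurableT_comp (measurable_dotv z)).
- exact: measurable_rV_box.
Qed.

Lemma norm_rV_attained (z : 'rV[R]_d) : 0 < `|z| -> exists i, `|z| = `|z ord0 i|.
Proof.
move=> z0; have /mx_norm_neq0[[j i] h] : mx_norm z != 0 by rewrite gt_eqF.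
by exists i; move: h; rewrite [j]ord1.
Qed.

(** The integral is a product over coordinates. A coordinate attaining the max norm contributes at
    most 2 / |z|, and each of the other d - 1 at most 2 r. *)
Lemma box_cos_decay (e : R) : 0 < e -> exists K, forall z : 'rV[R]_d, K < `|z| ->
  `|\int[lebd]_(l in rV_box) cos (dotv l z)| <= e.
Proof.
move=> e0; have c0 : 0 < (2 * r) ^+ d.-1 by rewrite exprn_gt0// mulr_gt0.
exists (2 * (2 * r) ^+ d.-1 / e) => z Kz.
have z0 : 0 < `|z| by apply: le_lt_trans Kz; rewrite divr_ge0 ?mulr_ge0// ltW.
have [i zi] := norm_rV_attained z0.
rewrite Rintegral_box_cos (bigD1 i)//= normrM normr_prod.
apply: (@le_trans _ _ (2 / `|z| * (2 * r) ^+ d.-1)).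
  apply: ler_pM; rewrite ?normr_ge0 ?prodr_ge0//.
    by rewrite zi; apply: itv_cos_decay; rewrite -zi.
  rewrite -[d in X in _ <= X](card_ord d) -(cardC1 i) -prodr_const.
  apply: ler_prod => j _; rewrite normr_ge0/=; exact: itv_cos_le.
by rewrite mulrAC ler_pdivrMr// mulrC [e * _]mulrC; have := ltW Kz; rewrite ler_pdivrMr// mulrC.
Qed.

Variables (n : nat) (x : 'I_n.+1 -> 'rV[R]_d) (s : 'I_n.+1 -> R) (eta : R).
Hypothesis s1 : forall i, `|s i| <= 1.
Hypothesis etaB : forall i j, i != j ->
  `|\int[lebd]_(l in rV_box) cos (dotv l (x i - x j))| <= eta.
Hypothesis etaD : forall i j, i != j ->
  `|\int[lebd]_(l in rV_box) cos (dotv l (x i + x j))| <= eta.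
Hypothesis eta0 : 0 <= eta.

Definition mean_cos (l : borel_rV R d) : R :=
  n.+1%:R^-1 * \sum_(i < n.+1) s i * cos (dotv l (x i)).

Lemma measurable_mean_cos : measurable_fun setT mean_cos.
Proof.
apply: measurable_funM => //; apply: measurable_sum => i.
by apply: measurable_funM => //; apply: measurable_cos_phase; exact: measurable_dotv.
Qed.

Lemma mean_cos_le1 l : `|mean_cos l| <= 1.
Proof.
rewrite normrM normfV normr_nat ler_pdivrMl// mulr1.
apply: (le_trans (ler_norm_sum _ _ _)).
rewrite (le_trans (ler_sum _ (fun i _ => _ : _ <= 1)))//; last first.
  by rewrite sumr_const card_ord.
by move=> i; rewrite normrM mulr_ile1// cos_max.
Qed.

Let cc (ij : 'I_n.+1 * 'I_n.+1) l :=
  (s ij.1 * s ij.2 / 2) * cos (dotv l (x ij.1 - x ij.2)) +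
  (s ij.1 * s ij.2 / 2) * cos (dotv l (x ij.1 + x ij.2)).

Let mean_cosE l : mean_cos l ^+ 2 = n.+1%:R ^- 2 * \sum_ij cc ij l.
Proof.
rewrite exprMn exprVn; congr (_ * _); rewrite expr2 big_distrlr/= pair_big/=.
apply: eq_bigr => -[i j] _; rewrite /cc/=.
have dB : dotv l (x i - x j) = dotv l (x i) - dotv l (x j).
  by rewrite /dotv -sumrB; apply: eq_bigr => k _; rewrite !mxE mulrBr.
have dD : dotv l (x i + x j) = dotv l (x i) + dotv l (x j).
  by rewrite /dotv -big_split; apply: eq_bigr => k _; rewrite !mxE mulrDr.
by rewrite dB dD cosB cosD; field.
Qed.

(** The product-to-sum formula turns the square into box integrals at [x i - x j] and [x i + x j],
    each with a coefficient at most 1/2. Off the diagonal both are at most [eta]; on the diagonal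
    both are at most the volume of the box. *)
Lemma mean_cos_sqr_le : lebd.-integrable rV_box (EFin \o (fun l => mean_cos l ^+ 2)) /\
  \int[lebd]_(l in rV_box) (mean_cos l ^+ 2) <= (2 * r) ^+ d / n.+1%:R + eta.
Proof.
have mB := measurable_rV_box.
have icos (z : 'rV[R]_d) : lebd.-integrable rV_box (EFin \o (fun l => cos (dotv l z))).
  exact: integrable_box_cos.
have icc ij : lebd.-integrable rV_box (EFin \o cc ij).
  exact: (integrable_lin mB _ _ (icos _) (icos _)).
have isum := integrable_Rsum mB (index_enum _) icc.
split.
  have := integrableZl mB (n.+1%:R ^- 2) isum.
  congr (_.-integrable _ _); apply/funext => l /=.
  by rewrite mean_cosE EFinM.
under eq_Rintegral do rewrite mean_cosE.
rewrite RintegralZl// (Rintegral_sum mB)//.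
have b0 : 0 <= (2 * r) ^+ d by rewrite exprn_ge0// mulr_ge0// ltW.
apply: (@le_trans _ _ (n.+1%:R ^- 2 *
    \sum_(ij : 'I_n.+1 * 'I_n.+1) ((ij.1 == ij.2)%:R * (2 * r) ^+ d + eta))).
  rewrite ler_wpM2l ?invr_ge0 ?exprn_ge0//; apply: ler_sum => -[i j] _.
  rewrite (Rintegral_lin mB _ _ (icos _) (icos _))/=.
  rewrite -mulrDr.
  set IB := \int[_]_(_ in _) _; set ID := \int[_]_(_ in _) _.
  have s2 : `|s i * s j / 2| <= 2^-1.
    by rewrite normrM normfV normr_nat ler_piMl// normrM mulr_ile1.
  have bnd (z : 'rV[R]_d) : `|\int[lebd]_(l in rV_box) cos (dotv l z)| <= (2 * r) ^+ d.
    rewrite Rintegral_box_cos normr_prod.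
    rewrite -[d in X in _ <= X](card_ord d) -prodr_const.
    apply: ler_prod => k _; rewrite normr_ge0/=; exact: itv_cos_le.
  suff h : `|IB + ID| <= 2 * ((i == j)%:R * (2 * r) ^+ d + eta).
    apply: (le_trans (ler_norm _)); rewrite normrM.
    rewrite (le_trans (ler_pM _ _ s2 h))// mulKf//.
  rewrite (le_trans (ler_normD _ _))//; have [ij|ij] := eqVneq i j.
    rewrite mul1r mulr_natl mulr2n; apply: lerD; apply: (le_trans (bnd _)); by rewrite lerDl.
  rewrite mul0r add0r mulr_natl mulr2n; apply: lerD; [exact: etaB|exact: etaD].
rewrite -(pair_big xpredT xpredT (fun i j : 'I_n.+1 => (i == j)%:R * (2 * r) ^+ d + eta))/=.
rewrite (eq_bigr (fun=> (2 * r) ^+ d + n.+1%:R * eta)); last first.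
  move=> i _; rewrite big_split/= sumr_const card_ord -[_ *+ n.+1]mulr_natl; congr (_ + _).
  rewrite (bigD1 i)//= eqxx mul1r big1 ?addr0// => j ji.
  by rewrite eq_sym (negbTE ji) mul0r.
rewrite sumr_const card_ord -mulr_natl le_eqVlt; apply/predU1P; left.
by field; rewrite addrC natr1 pnatr_eq0.
Qed.

End rV_box.

Section riemann_lebesgue.
Context {R : realType} {d : nat}.
Local Notation lebd := (@lebesgue_rV R d).

Lemma bounded_density_le (F : {measure set (borel_rV R d) -> \bar R})
    (f : borel_rV R d -> R) (M : R) : is_density F f -> (forall l, `|f l| <= M) ->
  forall A, measurable A -> (F A <= M%:E * lebd A)%E.
Proof.
move=> [mf f0 Ff] fM A mA; rewrite Ff// -integral_cst//.
apply: ge0_le_integral => //.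
- by move=> l _; rewrite lee_fin.
- by apply/measurable_EFinP; exact: measurable_funTS.
- by move=> l _; rewrite lee_fin (le_trans _ (fM l))// ler_norm.
Qed.

Lemma norm_coord_le (z : 'rV[R]_d) i : `|z ord0 i| <= `|z|.
Proof.
rewrite -[leRHS]/(mx_norm z) mx_normrE.
exact: (le_bigmax _ (fun ij : 'I_1 * 'I_d => `|z ij.1 ij.2|) (ord0, i)).
Qed.

Lemma rV_box_tight (F : {finite_measure set (borel_rV R d) -> \bar R}) (e : R) :
  0 < e -> exists2 r, 0 < r & (F (~` @rV_box R d r) <= e%:E)%E.
Proof.
move=> e0; pose C n : set (borel_rV R d) := ~` @rV_box R d n.+1%:R.
have mC n : measurable (C n) by apply: measurableC; exact: measurable_rV_box.
have C0 : \bigcap_n C n = set0.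
  rewrite -subset0 => l /= Cl.
  pose n := Num.truncn `|l|.
  apply: (Cl n Logic.I) => i /=; rewrite in_itv/= -ler_norml ltW//.
  apply: le_lt_trans (truncnS_gt `|l|).
  exact: norm_coord_le.
have : F \o C @ \oo --> F (\bigcap_n C n).
  apply: nonincreasing_cvg_mu => //.
  - by rewrite -ge0_fin_numE// fin_num_measure.
  - by rewrite C0.
  - move=> m n mn; apply/subsetPset; apply: subsetC => l /= hl i.
    by have := hl i; rewrite /= !in_itv/= => /andP[h1 h2]; rewrite (le_trans _ h1) ?(le_trans h2) ?lerN2 ?ler_nat.
rewrite C0 measure0 => /fine_cvgP[_ /cvgr0Pnorm_le /(_ e e0)[n _ /(_ n (leqnn n))]].
move=> /= h; exists n.+1%:R => //.
have Ffin : F (C n) \is a fin_num by rewrite fin_num_measure.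
rewrite -[X in (X <= _)%E](fineK Ffin).
by rewrite lee_fin (le_trans (ler_norm _) h).
Qed.

(** On the box, G <= al/2 + G^2 / (2 al), because the difference is the square (al - G)^2 / (2 al).
    The right side is nonnegative, so its [F]-integral is at most [M] times its Lebesgue integral,
    where the L^2 bound applies. Off the box |G| <= 1 costs at most [t]. *)
Lemma cos_expectation_bound (F : {finite_measure set (borel_rV R d) -> \bar R})
    (M r al t eta : R) (n : nat) (x : 'I_n.+1 -> 'rV[R]_d) (s : 'I_n.+1 -> R) :
  0 < r -> 0 < al -> 0 <= M -> 0 <= eta ->
  (forall A, measurable A -> (F A <= M%:E * lebd A)%E) ->
  (F (~` @rV_box R d r) <= t%:E)%E ->
  (forall i, `|s i| <= 1) ->
  (forall i j, i != j ->
    `|\int[lebd]_(l in rV_box r) cos (dotv l (x i - x j))| <= eta) ->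
  (forall i j, i != j ->
    `|\int[lebd]_(l in rV_box r) cos (dotv l (x i + x j))| <= eta) ->
  \int[F]_l mean_cos x s l <=
  M * (al / 2 * (2 * r) ^+ d + (2 * al)^-1 * ((2 * r) ^+ d / n.+1%:R + eta)) + t.
Proof.
move=> r0 al0 M0 eta0 FM Ft s1 etaB etaD.
have mB := @measurable_rV_box R d r.
have mG := measurable_mean_cos x s.
have G1 l : `|mean_cos x s l| <= 1 by exact: mean_cos_le1.
have [iG2 leG2] := mean_cos_sqr_le r0 s1 etaB etaD eta0.
pose h l := al / 2 * 1 + (2 * al)^-1 * mean_cos x s l ^+ 2.
have al2 : 0 <= (2 * al)^-1 by rewrite invr_ge0 mulr_ge0// ltW.
have h0 l : 0 <= h l.
  by apply: addr_ge0; [rewrite mulr1 divr_ge0// ltW|rewrite mulr_ge0// sqr_ge0].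
have mh : measurable_fun setT h.
  by apply: measurable_funD => //; apply: measurable_funM => //; exact: measurable_funX.
have Gh l : mean_cos x s l <= h l.
  have -> : h l = (2 * al)^-1 * (al - mean_cos x s l) ^+ 2 + mean_cos x s l.
    by rewrite /h; field; rewrite gt_eqF.
  by rewrite lerDr mulr_ge0 ?sqr_ge0// invr_ge0 mulr_ge0// ltW.
have iG : F.-integrable setT (EFin \o mean_cos x s).
  apply: measurable_bounded_integrable => //.
    by rewrite -ge0_fin_numE// fin_num_measure.
  by exists 1; split => // y y1 l _ /=; rewrite (le_trans (G1 l))// ltW.
have ibG : lebd.-integrable (rV_box r) (EFin \o (fun=> 1 : R)).
  apply: measurable_bounded_integrable => //.
    by rewrite [X in (X < _)%E]lebesgue_rV_boxE// ltry.
  by exists 1; split => // y y1 l _ /=; rewrite normr1 ltW.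
have ih : lebd.-integrable (rV_box r) (EFin \o h) by exact: (integrable_lin mB _ _ ibG iG2).
have hE : \int[lebd]_(l in rV_box r) h l <=
    al / 2 * (2 * r) ^+ d + (2 * al)^-1 * ((2 * r) ^+ d / n.+1%:R + eta).
  rewrite (Rintegral_lin mB _ _ ibG iG2) Rintegral_cst// mul1r.
  rewrite [X in fine X](lebesgue_rV_boxE r0) /= lerD2l ler_wpM2l// invr_ge0 mulr_ge0// ltW.
have split_F : \int[F]_l mean_cos x s l =
    \int[F]_(l in rV_box r) mean_cos x s l + \int[F]_(l in ~` rV_box r) mean_cos x s l.
  rewrite -[in LHS](setvU (rV_box r)) setUC Rintegral_setU//.
  - exact: measurableC.
  - by rewrite setUv.
  - by apply/disj_setPS => l [].
rewrite split_F; apply: lerD.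
  apply: (@le_trans _ _ (M * \int[lebd]_(l in rV_box r) h l)); last by rewrite ler_wpM2l.
  have int_le : (\int[F]_(l in rV_box r) (h l)%:E <= M%:E * \int[lebd]_(l in rV_box r) (h l)%:E)%E.
    pose k : {nonneg R} := NngNum M0.
    rewrite -[M]/(k%:num) -ge0_integral_mscale//; last 2 first.
    - by apply/measurable_EFinP; exact: measurable_funTS.
    - by move=> l _; rewrite lee_fin.
    apply: ge0_le_measure_integral => //.
    exact/measurable_EFinP.
  have fin_leb : (\int[lebd]_(l in rV_box r) (h l)%:E)%E \is a fin_num by exact: integrable_fin_num.
  have ihF : F.-integrable (rV_box r) (EFin \o h).
    apply/integrableP; split; first by apply/measurable_EFinP; exact: measurable_funTS.
    under eq_integral do rewrite /= ger0_norm//.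
    by apply: le_lt_trans int_le _; rewrite -(fineK fin_leb) -EFinM ltry.
  apply: (@le_trans _ _ (\int[F]_(l in rV_box r) h l)).
    apply: le_Rintegral => //; exact: (integrableS measurableT).
  rewrite -lee_fin /Rintegral EFinM !fineK//; exact: integrable_fin_num.
apply: (@le_trans _ _ (\int[F]_(l in ~` rV_box r) (1 : R))).
  have mBC := measurableC mB.
  apply: le_Rintegral => //; first exact: (integrableS measurableT).
    apply: measurable_bounded_integrable => //.
      by rewrite -ge0_fin_numE// fin_num_measure.
    by exists 1; split => // y y1 l _ /=; rewrite normr1 ltW.
  by move=> l _; rewrite (le_trans (ler_norm _)).
rewrite Rintegral_cst ?mul1r; last exact: measurableC.
by rewrite -lee_fin fineK// fin_num_measure//; exact: measurableC.
Qed.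

(** By contradiction: if infinitely many far apart frequencies had integrals of size at least [e],
    their signed average would have [F]-integral at least [e], against the bound for near-orthogonal
    cosines. *)
Lemma riemann_lebesgue_cos (F : {finite_measure set (borel_rV R d) -> \bar R}) (M : R) :
  (forall A, measurable A -> (F A <= M%:E * lebd A)%E) ->
  forall e, 0 < e -> exists K, forall z : 'rV[R]_d, K < `|z| ->
    `|\int[F]_l cos (dotv l z)| < e.
Proof.
move=> FM' e e0.
(* A strictly positive bound is needed as a denominator below. *)
pose M1 := `|M| + 1.
have M0 : 0 < M1 by rewrite ltr_wpDl.
have FM A : measurable A -> (F A <= M1%:E * lebd A)%E.
  move=> mA; apply: (le_trans (FM' A mA)); rewrite lee_wpmul2r// lee_fin.
  by rewrite (le_trans (ler_norm _))// lerDl.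
have [r r0 Ft] := @rV_box_tight F (e / 4) ltac:(by rewrite divr_gt0).
pose b := (2 * r) ^+ d; have b0 : 0 < b by rewrite exprn_gt0// mulr_gt0.
(* [al], [eta] and [n] are tuned so that the final bound is e/8 from the [al / 2] term, e/4 from the
   mean square ([b / n.+1%:R] and [eta], each at most [eta]), and e/4 from the tail: 5e/8 in all. *)
pose al := e / (4 * M1 * b).
have al0 : 0 < al by rewrite divr_gt0 ?mulr_gt0.
pose eta := e * al / (4 * M1).
have eta0 : 0 < eta by rewrite divr_gt0// mulr_gt0.
pose n := Num.truncn (4 * M1 * b / (al * e)).
have n_large : b / n.+1%:R <= eta.
  rewrite ler_pdivrMr// mulrC -ler_pdivrMr//; apply/ltW.
  apply: le_lt_trans (truncnS_gt (4 * M1 * b / (al * e))).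
  rewrite le_eqVlt; apply/predU1P; left; rewrite /eta; field.
  by rewrite !gt_eqF.
have [L0 L0P] := @box_cos_decay R d r r0 eta eta0.
pose L := Num.max L0 0 + 1.
have L_gt0 : 0 < L by rewrite ltr_wpDl// le_max lexx orbT.
have LP z : L <= `|z| -> `|\int[lebd]_(l in rV_box r) cos (dotv l z)| <= eta.
  move=> Lz; apply: L0P; apply: lt_le_trans Lz.
  by rewrite /L ltr_pwDr// le_max lexx.
apply: contrapT => nK.
have /choice[phi phiP] : forall K, exists z : 'rV[R]_d, K < `|z| /\ e <= `|\int[F]_l cos (dotv l z)|.
  move=> K; apply: contrapT => h; apply: nK; exists K => z Kz.
  by rewrite ltNge; apply/negP => ez; apply: h; exists z.
(* Each norm exceeds the previous one by more than [L], so sums as well as differences of distinct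
   frequencies have norm at least [L]; the product-to-sum formula needs both. *)
pose x (k : nat) : 'rV[R]_d := iter k (fun z => phi (`|z| + L)) (phi 0).
have xe k : e <= `|\int[F]_l cos (dotv l (x k))|.
  by case: k => [|k]; [exact: (phiP 0).2|exact: (phiP (`|x k| + L)).2].
have xL i j : (i < j)%N -> `|x i| + L <= `|x j|.
  elim: j => // j ih; rewrite ltnS leq_eqVlt => /predU1P[->|ij].
    exact: ltW (phiP (`|x j| + L)).1.
  apply: (le_trans (ih ij)); apply: ltW; apply: le_lt_trans (phiP (`|x j| + L)).1.
  by rewrite lerDl ltW.
have sep i j (sg : R) : `|sg| = 1 -> i != j -> L <= `|x i + sg *: x j|.
  move=> sg1; rewrite neq_ltn => /orP[ij|ji].
    have := xL _ _ ij; have := lerB_normD (sg *: x j) (x i).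
    by rewrite normrZ sg1 mul1r [sg *: x j + x i]addrC; lra.
  have := xL _ _ ji; have := lerB_normD (x i) (sg *: x j).
  by rewrite normrZ sg1 mul1r; lra.
(* With these signs every term of the average integrates to an absolute value, hence to at least
   [e]. *)
pose s (i : 'I_n.+1) : R := Num.sg (\int[F]_l cos (dotv l (x i))).
have s1 i : `|s i| <= 1 by rewrite normr_sg lern1 leq_b1.
have etaB (i j : 'I_n.+1) : i != j ->
    `|\int[lebd]_(l in rV_box r) cos (dotv l (x i - x j))| <= eta.
  by move=> ij; apply: LP; rewrite -scaleN1r; apply: sep; rewrite ?normrN1.
have etaD (i j : 'I_n.+1) : i != j ->
    `|\int[lebd]_(l in rV_box r) cos (dotv l (x i + x j))| <= eta.
  by move=> ij; apply: LP; rewrite -[x j]scale1r; apply: sep; rewrite ?normr1.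
have := @cos_expectation_bound F M1 r al (e / 4) eta n (fun i => x i) s r0 al0 (ltW M0)
  (ltW eta0) FM Ft s1 etaB etaD.
apply/negP; rewrite -ltNge.
have ic z : F.-integrable setT (EFin \o (fun l => cos (dotv l z))).
  apply: integrable_cos => //; last exact: measurable_dotv.
  by rewrite -ge0_fin_numE// fin_num_measure.
have isc (i : 'I_n.+1) : F.-integrable setT (EFin \o (fun l => s i * cos (dotv l (x i)))).
  exact: (integrableZl measurableT (s i) (ic (x i))).
apply: (@lt_le_trans _ _ e); last first.
  rewrite /mean_cos RintegralZl//; last exact: (integrable_Rsum measurableT).
  rewrite (Rintegral_sum measurableT)// ler_pdivlMl//.
  rewrite -[X in X * e](_ : \sum_(i < n.+1) (1 : R) = _); last by rewrite sumr_const card_ord.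
  rewrite mulr_suml; apply: ler_sum => i _; rewrite mul1r (RintegralZl _ measurableT (ic (x i))).
  by rewrite -[X in _ <= X]/(Num.sg _ * _) -normrEsg.
rewrite -/b; apply: (@le_lt_trans _ _ (M1 * (al / 2 * b + (2 * al)^-1 * (eta + eta)) + e / 4)).
  by rewrite lerD2r ler_wpM2l ?(ltW M0)// lerD2l ler_wpM2l ?lerD2r// invr_ge0 mulr_ge0// ltW.
have -> : M1 * (al / 2 * b + (2 * al)^-1 * (eta + eta)) = 3 * e / 8.
  by rewrite /eta /al; field; rewrite !gt_eqF.
lra.
Qed.

End riemann_lebesgue.

(** * Pairs of observation points *)

Section pair_sums.
Context {R : realType} {n : nat} {d : measure_display} {T : measurableType d}.
Variables (P : probability T R) (xi : T -> 'rV[R]_n -> R).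
Hypothesis mxi : measurable_fun [set: T] (xi : T -> field_space R n).
Hypotheses (gxi : gaussian_field P xi) (xi0 : mean_zero P xi).
Variable k : 'rV[R]_n -> R.
Hypothesis kP : stationary_with P xi k.
Implicit Types p q : 'rV[R]_n * 'rV[R]_n.

Definition pair_sum p (w : T) : R := xi w p.1 + xi w p.2.

Lemma field_cov x y : \int[P]_w (xi w x * xi w y) = k (x - y).
Proof. by rewrite -kP /covariance_fun unlock. Qed.

Lemma measurable_pair_sum p : measurable_fun setT (pair_sum p).
Proof. by apply: measurable_funD; exact: measurable_field_at. Qed.

Lemma pair_sum_fourth p : gaussian_fourth P (pair_sum p).
Proof.
have := @field_comb_fourth _ _ _ _ P xi mxi gxi xi0 2
  (fun i => nth 0 [:: p.1; p.2] i) (fun=> 1).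
by under eq_fun do rewrite !big_ord_recl big_ord0 /= !mul1r addr0.
Qed.

Lemma pair_sum_fourthD p q :
  gaussian_fourth P (fun w => pair_sum p w + pair_sum q w).
Proof.
have := @field_comb_fourth _ _ _ _ P xi mxi gxi xi0 4
  (fun i => nth 0 [:: p.1; p.2; q.1; q.2] i) (fun=> 1).
under eq_fun do rewrite !big_ord_recl big_ord0 /= !mul1r addr0.
by congr gaussian_fourth; apply/funext => w; rewrite /pair_sum -!addrA.
Qed.

Lemma pair_sum_fourthB p q :
  gaussian_fourth P (fun w => pair_sum p w - pair_sum q w).
Proof.
have := @field_comb_fourth _ _ _ _ P xi mxi gxi xi0 4
  (fun i => nth 0 [:: p.1; p.2; q.1; q.2] i) (fun i => nth 0 [:: 1; 1; -1; -1] i).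
under eq_fun do rewrite !big_ord_recl big_ord0 /= !mul1r !mulN1r addr0.
by congr gaussian_fourth; apply/funext => w; rewrite /pair_sum opprD -!addrA.
Qed.

Lemma pair_sum_cov p q : \int[P]_w (pair_sum p w * pair_sum q w) =
  k (p.1 - q.1) + k (p.1 - q.2) + k (p.2 - q.1) + k (p.2 - q.2).
Proof.
have ixy x y : P.-integrable setT (EFin \o (fun w => xi w x * xi w y)).
  apply: integrable_mul; [exact: measurable_field_at..| |].
    by have [] := field_fourth mxi gxi xi0 x.
  by have [] := field_fourth mxi gxi xi0 y.
have i1 := integrable_lin measurableT 1 1 (ixy p.1 q.1) (ixy p.1 q.2).
have i2 := integrable_lin measurableT 1 1 (ixy p.2 q.1) (ixy p.2 q.2).
rewrite (eq_Rintegral _ (g := fun w => 1 * (1 * (xi w p.1 * xi w q.1) + 1 * (xi w p.1 * xi w q.2)) +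
  1 * (1 * (xi w p.2 * xi w q.1) + 1 * (xi w p.2 * xi w q.2)))); last first.
  by move=> w _; rewrite /pair_sum; ring.
rewrite (Rintegral_lin measurableT _ _ i1 i2).
rewrite (Rintegral_lin measurableT _ _ (ixy p.1 q.1) (ixy p.1 q.2)).
rewrite (Rintegral_lin measurableT _ _ (ixy p.2 q.1) (ixy p.2 q.2)).
by rewrite !field_cov !mul1r !addrA.
Qed.

Hypothesis kiso : isotropic k.

Lemma enormN (x : 'rV[R]_n) : enorm (- x) = enorm x.
Proof. by congr Num.sqrt; apply: eq_bigr => i _; rewrite mxE sqrrN. Qed.

Lemma pair_sum_var p z : enorm (p.1 - p.2) = enorm z ->
  \int[P]_w (pair_sum p w ^+ 2) = 2 * (k 0 + k z).
Proof.
move=> pz; under eq_Rintegral do rewrite expr2.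
rewrite pair_sum_cov !subrr (kiso pz).
have -> : k (p.2 - p.1) = k z by apply: kiso; rewrite -enormN opprB.
ring.
Qed.

(** Two pairs have four cross covariances, so [eta / 4] for each bounds the covariance of the sums
    by [eta]. *)
Lemma pair_sum_concentration (N : nat) (p : 'I_N.+1 -> 'rV[R]_n * 'rV[R]_n)
    z (eta delta : R) : 0 < delta ->
  (forall i, enorm ((p i).1 - (p i).2) = enorm z) ->
  (forall i j, i != j -> [/\ `|k ((p i).1 - (p j).1)| <= eta / 4,
     `|k ((p i).1 - (p j).2)| <= eta / 4, `|k ((p i).2 - (p j).1)| <= eta / 4 &
     `|k ((p i).2 - (p j).2)| <= eta / 4]) ->
  (P [set w | (delta <= `|mean_sqr (fun i => pair_sum (p i)) w - 2 * (k 0 + k z)|)%R] <=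
   ((2 * (2 * (k 0 + k z)) ^+ 2 / N.+1%:R + 2 * eta ^+ 2) / delta ^+ 2)%:E)%E.
Proof.
move=> delta0 pz pcov; apply: mean_sqr_chebyshev => //.
- by move=> i; exact: measurable_pair_sum.
- by move=> i; exact: pair_sum_fourth.
- by move=> i j; exact: pair_sum_fourthD.
- by move=> i j; exact: pair_sum_fourthB.
- by move=> i; exact: pair_sum_var.
- move=> i j ij; have [h1 h2 h3 h4] := pcov i j ij.
  rewrite pair_sum_cov; move: h1 h2 h3 h4; rewrite !ler_norml.
  by move=> /andP[? ?] /andP[? ?] /andP[? ?] /andP[? ?]; apply/andP; split; lra.
Qed.

End pair_sums.

(** * Separating the two laws by means of far apart pairs *)

Section separation.
Context {R : realType} {n : nat} {d : measure_display} {T : measurableType d}.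
Variables (P1 P2 : probability T R) (xi : T -> 'rV[R]_n -> R).
Hypothesis mxi : measurable_fun [set: T] (xi : T -> field_space R n).
Hypotheses (g1 : gaussian_field P1 xi) (g2 : gaussian_field P2 xi).
Hypotheses (m1 : mean_zero P1 xi) (m2 : mean_zero P2 xi).
Variables k1 k2 : 'rV[R]_n -> R.
Hypotheses (s1 : stationary_with P1 xi k1) (s2 : stationary_with P2 xi k2).
Hypotheses (iso1 : isotropic k1) (iso2 : isotropic k2).

(** Distance to infinity is measured in the max norm, which suits the coordinatewise decay on boxes;
    [enorm] is kept for isotropy. *)
Definition vanishes_at_infinity (k : 'rV[R]_n -> R) :=
  forall e : R, 0 < e -> exists K : R, forall x, K < `|x| -> `|k x| < e.

Hypotheses (van1 : vanishes_at_infinity k1) (van2 : vanishes_at_infinity k2).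

Lemma sigma_field_measurable D : sigma_field xi D `<=` @measurable _ T.
Proof.
apply: smallest_sub; first exact: sigma_algebra_measurable.
move=> A [x _ [B mB <-]]; exact: measurable_field_at.
Qed.

(** [T] with [sigma_field xi D] as its measurable structure, so that membership in this
    sigma-algebra can be proved by the usual closure lemmas for measurable functions. *)
Local Notation sigma_fieldType D := (g_sigma_algebraType (\bigcup_(x in D)
  preimage_set_system [set: T] (fun w => xi w x) (@measurable _ (measurableTypeR R)))).

Lemma sigma_field_pair_sum (D : set 'rV[R]_n) p : D p.1 -> D p.2 ->
  measurable_fun setT (pair_sum xi p : sigma_fieldType D -> measurableTypeR R).
Proof.
have mx x : D x -> measurable_fun setT ((fun w => xi w x) : sigma_fieldType D -> measurableTypeR R).
  by move=> Dx _ B mB; apply: sub_sigma_algebra; exists x => //; exists B.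
by move=> Dp1 Dp2; apply: measurable_funD; exact: mx.
Qed.

Variables (D : set 'rV[R]_n) (z : 'rV[R]_n).
Hypothesis neq_var : k1 0 + k1 z != k2 0 + k2 z.
Hypothesis far_pairs : forall K : R, exists p : nat -> 'rV[R]_n * 'rV[R]_n,
  (forall i, [/\ D (p i).1, D (p i).2 & enorm ((p i).1 - (p i).2) = enorm z]) /\
  (forall i j, i != j -> [/\ K < `|(p i).1 - (p j).1|,
    K < `|(p i).1 - (p j).2|, K < `|(p i).2 - (p j).1| & K < `|(p i).2 - (p j).2|]).

(** The separating event says that the empirical mean square is at least [delta], half the gap, away
    from [v1]. It is rare under [P1]; its complement forces a deviation of at least [delta] from
    [v2], which is rare under [P2]. *)
Lemma orthogonal_of_far_pairs : orthogonal_on (sigma_field xi D) P1 P2.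
Proof.
apply: orthogonal_of_separating; first exact: sigma_field_measurable.
move=> e e0.
pose v1 := 2 * (k1 0 + k1 z); pose v2 := 2 * (k2 0 + k2 z).
pose delta := `|v1 - v2| / 2.
have delta0 : 0 < delta.
  by rewrite divr_gt0// normr_gt0 -mulrBr mulf_neq0 ?subr_eq0.
(* Capping at 1 gives m^2 <= m <= e, so that 2 eta^2 / delta^2 = m^2 / 2 is at most e / 2. *)
pose m := Num.min 1 e.
have m0 : 0 < m by rewrite lt_min ltr01.
have m_le1 : m <= 1 by rewrite ge_min lexx.
have m_le : m <= e by rewrite ge_min lexx orbT.
pose eta := delta * m / 2.
have eta0 : 0 < eta by rewrite divr_gt0// mulr_gt0.
have eta4 : 0 < eta / 4 by rewrite divr_gt0.
(* Makes the diagonal term at most e / 2 as well; the sum of both squares lets one [N] serve both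
   measures. *)
pose N := Num.truncn (4 * (v1 ^+ 2 + v2 ^+ 2) / (delta ^+ 2 * e)).
have bound v : v ^+ 2 <= v1 ^+ 2 + v2 ^+ 2 ->
    (2 * v ^+ 2 / N.+1%:R + 2 * eta ^+ 2) / delta ^+ 2 <= e.
  move=> vle; have d2 : 0 < delta ^+ 2 by rewrite exprn_gt0.
  rewrite ler_pdivrMr//.
  have h1 : 2 * v ^+ 2 / N.+1%:R <= delta ^+ 2 * e / 2.
    rewrite ler_pdivrMr//.
    have := truncnS_gt (4 * (v1 ^+ 2 + v2 ^+ 2) / (delta ^+ 2 * e)).
    rewrite ltr_pdivrMr ?(mulr_gt0 d2 e0)// -/N => hN.
    have -> : delta ^+ 2 * e / 2 * N.+1%:R = N.+1%:R * (delta ^+ 2 * e) / 2 by field.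
    by rewrite ler_pdivlMr//; apply/ltW; apply: le_lt_trans hN; lra.
  have h2 : 2 * eta ^+ 2 <= delta ^+ 2 * e / 2.
    have -> : 2 * eta ^+ 2 = delta ^+ 2 * (m * m) / 2 by rewrite /eta; field.
    by rewrite ler_pM2r// ler_wpM2l ?(ltW d2)// (le_trans _ m_le)// ler_piMl// ltW.
  have -> : e * delta ^+ 2 = delta ^+ 2 * e / 2 + delta ^+ 2 * e / 2 by field.
  exact: lerD.
have [K1 K1P] := van1 eta4; have [K2 K2P] := van2 eta4.
have [p [pD pfar]] := far_pairs (Num.max K1 K2).
have small (k : 'rV[R]_n -> R) K : (forall x, K < `|x| -> `|k x| < eta / 4) -> K <= Num.max K1 K2 ->
    forall i j, i != j -> [/\ `|k ((p i).1 - (p j).1)| <= eta / 4,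
     `|k ((p i).1 - (p j).2)| <= eta / 4, `|k ((p i).2 - (p j).1)| <= eta / 4 &
     `|k ((p i).2 - (p j).2)| <= eta / 4].
  move=> kK KK i j ij; have [h1 h2 h3 h4] := pfar i j ij.
  by split; apply/ltW/kK; apply: le_lt_trans KK _.
pose S := mean_sqr (fun i : 'I_N.+1 => pair_sum xi (p i)).
have pz (i : 'I_N.+1) : enorm ((p i).1 - (p i).2) = enorm z by case: (pD i).
have KK1 : K1 <= Num.max K1 K2 by rewrite le_max lexx.
have KK2 : K2 <= Num.max K1 K2 by rewrite le_max lexx orbT.
have C1 := @pair_sum_concentration _ _ _ _ P1 xi mxi g1 m1 k1 s1 iso1 N (fun i => p i) z
  eta delta delta0 pz (fun i j : 'I_N.+1 => @small k1 K1 K1P KK1 i j).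
have C2 := @pair_sum_concentration _ _ _ _ P2 xi mxi g2 m2 k2 s2 iso2 N (fun i => p i) z
  eta delta delta0 pz (fun i j : 'I_N.+1 => @small k2 K2 K2P KK2 i j).
have mS : measurable_fun setT (S : sigma_fieldType D -> measurableTypeR R).
  apply: measurable_funM => //; apply: measurable_sum => i; apply: measurable_funX.
  by apply: sigma_field_pair_sum; case: (pD i).
have mA v : sigma_field xi D [set w | delta <= `|S w - v|].
  have mf : measurable_fun setT ((fun w => `|S w - v|) : sigma_fieldType D -> measurableTypeR R).
    by apply: measurableT_comp => //; exact: measurable_funB.
  rewrite (_ : [set w | _] = (fun w => `|S w - v|) @^-1` `[delta, +oo[).
    by rewrite -[X in sigma_field _ _ X]setTI; exact: (mf measurableT _ (measurable_itv _)).
  by apply/seteqP; split => w; rewrite /= in_itv/= andbT.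
exists [set w | delta <= `|S w - v1|]; split; first exact: mA.
  apply: (le_trans C1); rewrite lee_fin; apply: bound.
  by rewrite lerDl sqr_ge0.
apply: (@le_trans _ _ (P2 [set w | delta <= `|S w - v2|])).
  have mA' v := sigma_field_measurable (mA v).
  apply: le_measure; [by apply/mem_set/measurableC/mA'|by apply/mem_set/mA'|].
  move=> w /= /negP; rewrite -ltNge => Sv1.
  have : `|v1 - v2| <= `|S w - v1| + `|S w - v2|.
    by rewrite (distrC (S w) v1) (ler_distD (S w)).
  have : `|v1 - v2| = 2 * delta by rewrite /delta mulrC divfK.
  by move: Sv1; lra.
apply: (le_trans C2); rewrite lee_fin; apply: bound.
by rewrite lerDr sqr_ge0.
Qed.

End separation.

(** * Points on an unbounded curve *)

Section curve.
Context {R : realType} {d : nat}.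

Lemma enorm0 : enorm (0 : 'rV[R]_d) = 0.
Proof. by rewrite /enorm big1 ?sqrtr0// => i _; rewrite mxE expr0n. Qed.

Lemma norm_le_enorm (x : 'rV[R]_d) : `|x| <= enorm x.
Proof.
have [->|x0] := eqVneq x 0; first by rewrite normr0 enorm0.
have [|i ->] := @norm_rV_attained R d x; first by rewrite normr_gt0.
rewrite -sqrtr_sqr ler_wsqrtr// (bigD1 i)//= lerDl sumr_ge0// => j _.
exact: sqr_ge0.
Qed.

Lemma continuous_enorm : continuous (@enorm R d).
Proof.
have csum (s : seq 'I_d) : continuous (fun y : 'rV[R]_d => \sum_(i <- s) y ord0 i ^+ 2).
  elim: s => [|i s ih].
    by under eq_fun do rewrite big_nil; exact: cst_continuous.
  under eq_fun do rewrite big_cons.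
  move=> x; apply: (@continuousD _ R^o _ (fun y : 'rV[R]_d => y ord0 i ^+ 2)
    (fun y => \sum_(j <- s) y ord0 j ^+ 2)); last exact: ih.
  apply: (continuous_comp (f := fun y : 'rV[R]_d => y ord0 i) (g := fun u => u ^+ 2)).
    exact: coord_continuous.
  exact: exprn_continuous.
move=> x; apply: (continuous_comp (f := fun y : 'rV[R]_d => \sum_(i < d) y ord0 i ^+ 2)
  (g := Num.sqrt)); first exact: csum.
exact: sqrt_continuous.
Qed.

Variables (T : set R) (c : R -> 'rV[R]_d) (t0 : R).
Hypotheses (itvT : is_interval T) (Tt0 : T t0) (ct0 : c t0 = 0).
Hypothesis cont : {within T, continuous c}.
Hypothesis unb : ~ bounded_set [set c t | t in T].

Lemma curve_unbounded (M : R) : exists2 t, T t & M < `|c t|.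
Proof.
apply: contrapT => h; apply: unb; exists M; split; first exact: num_real.
move=> N MN _ [t Tt <-] /=; rewrite leNgt; apply/negP => Nt.
by apply: h; exists t => //; exact: lt_trans Nt.
Qed.

Lemma curve_IVT (phi : 'rV[R]_d -> R) (s t v : R) : continuous phi ->
  T s -> T t -> phi (c s) <= v -> v <= phi (c t) ->
  exists2 u, T u & phi (c u) = v.
Proof.
move=> cphi Ts Tt sv vt.
have Tsub a b : T a -> T b -> [set` `[a, b]] `<=` T.
  by move=> Ta Tb u; rewrite /= in_itv/=; exact: itvT.
have cw a b : T a -> T b -> {within [set` `[a, b]], continuous (fun u => phi (c u))}.
  move=> Ta Tb.
  have ccab : {within [set` `[a, b]], continuous c}.
    exact: continuous_subspaceW (Tsub a b Ta Tb) cont.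
  by move=> u; apply: (continuous_comp (ccab u)); exact: cphi.
have [st|ts] := leP s t.
  have [|u + uv] := IVT st (cw s t Ts Tt) (v := v).
    by rewrite ge_min sv/= le_max vt orbT.
  by move=> hu; exists u => //; exact: (Tsub s t).
have [|u + uv] := IVT (ltW ts) (cw t s Tt Ts) (v := v).
  by rewrite ge_min sv orbT/= le_max vt.
by move=> hu; exists u => //; exact: (Tsub t s).
Qed.

(* The first points of the pairs lie at max-norm distances [0, L, 2 L, ...] from
   the origin, and the intermediate value theorem gives each of them a companion
   at Euclidean distance [enorm z]. *)
Lemma curve_far_pairs (z : 'rV[R]_d) (K : R) :
  exists p : nat -> 'rV[R]_d * 'rV[R]_d,
  (forall i, [/\ [set c t | t in T] (p i).1, [set c t | t in T] (p i).2 &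
     enorm ((p i).1 - (p i).2) = enorm z]) /\
  (forall i j, i != j -> [/\ K < `|(p i).1 - (p j).1|,
    K < `|(p i).1 - (p j).2|, K < `|(p i).2 - (p j).1| & K < `|(p i).2 - (p j).2|]).
Proof.
pose r := enorm z; have r0 : 0 <= r by exact: sqrtr_ge0.
(* Replacing both first points by their companions shortens a distance by at most 2 r, so spacing
   [L] leaves more than [K]; the maximum with 0 keeps [L] positive for negative [K]. *)
pose L := Num.max K 0 + 2 * r + 1.
have KL : K + 2 * r < L.
  by rewrite /L ltr_pwDr// lerD2r le_max lexx.
have L0 : 0 < L by rewrite /L ltr_wpDl// addr_ge0 ?mulr_ge0// le_max lexx orbT.
have ex i : exists q : 'rV[R]_d * 'rV[R]_d, [/\ [set c t | t in T] q.1,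
    [set c t | t in T] q.2, enorm (q.1 - q.2) = r & `|q.1| = i%:R * L].
  have [t Tt Lt] := curve_unbounded (i%:R * L).
  have [|s Ts sL] := @curve_IVT Num.norm t0 t (i%:R * L) (@norm_continuous _ _) Tt0 Tt _ (ltW Lt).
    by rewrite ct0 normr0 mulr_ge0// ltW.
  (* The distance to [c s] is 0 at [s] itself and exceeds [r] at [t'], so it takes the value [r] in
     between. *)
  have [t' Tt' Lt'] := curve_unbounded (`|c s| + r).
  have cphi : continuous (fun y : 'rV[R]_d => enorm (c s - y)).
    move=> y; apply: (continuous_comp (f := fun y : 'rV[R]_d => c s - y) (g := @enorm R d)).
      by apply: continuousB; [exact: cst_continuous|exact: cvg_id].
    exact: continuous_enorm.
  have [| |u Tu ur] := @curve_IVT (fun y => enorm (c s - y)) s t' r cphi Ts Tt'.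
  - by rewrite subrr enorm0.
  - apply: le_trans (norm_le_enorm _).
    by have := lerB_dist (c t') (c s); rewrite distrC; lra.
  exists (c s, c u); split => //=; [by exists s|by exists u].
have [p pP] := choice ex.
exists p; split; first by move=> i; case: (pP i).
have near i : `|(p i).1 - (p i).2| <= r.
  by case: (pP i) => _ _ <- _; exact: norm_le_enorm.
have far i j : i != j -> L <= `|(p i).1 - (p j).1|.
  wlog ij : i j / (i < j)%N => [h|_].
    rewrite neq_ltn => /orP[ij|ji]; first by apply: h => //; rewrite ltn_eqF.
    by rewrite distrC; apply: h => //; rewrite ltn_eqF.
  case: (pP i) => _ _ _ iL; case: (pP j) => _ _ _ jL.
  have : i%:R * L + L <= j%:R * L.
    by rewrite -[X in _ + X]mul1r -mulrDl ler_pM2r// natr1 ler_nat.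
  rewrite -iL -jL => h; have := lerB_dist (p j).1 (p i).1; rewrite distrC; lra.
move=> i j ij; have := far i j ij.
have := near i; have := near j; case: (p i) => a b; case: (p j) => a' b' /=.
have := ler_distD b' a a'; have := ler_distD b a a'; have := ler_distD b' b a'.
rewrite (distrC b' a').
by split; lra.
Qed.

End curve.

(** * From spectral densities to covariances, and conclusion *)

Section spectral_density.
Context {R : realType} {d : nat}.
Local Notation lebd := (@lebesgue_rV R d).

Lemma spectral_cos (c : 'rV[R]_d -> 'rV[R]_d -> R)
    (F : {measure set (borel_rV R d) -> \bar R}) : spectral_representation c F ->
  forall x y, c x y = \int[F]_l cos (dotv l (x - y)).
Proof. by move=> h x y; case: (h x y). Qed.

(** Finiteness of [F] makes [f] integrable, and integrable functions with equal integrals over all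
    measurable sets agree almost everywhere. *)
Lemma density_unique (F : {finite_measure set (borel_rV R d) -> \bar R})
    (G : set (borel_rV R d) -> \bar R) (f g : borel_rV R d -> R) :
  is_density F f -> is_density G g ->
  (forall A, measurable A -> F A = G A) ->
  lebd [set l | f l != g l] = 0%E.
Proof.
move=> [mf f0 Ff] [mg g0 Gg] FG.
have intf : lebd.-integrable setT (EFin \o f).
  apply/integrableP; split; first exact/measurable_EFinP.
  under eq_integral do rewrite /= ger0_norm//.
  by rewrite -Ff// -ge0_fin_numE// fin_num_measure.
have ae : ae_eq lebd setT (EFin \o f) (EFin \o g).
  apply: integral_ae_eq => //; first exact/measurable_EFinP.
  by move=> E _ mE; rewrite -[LHS]Ff// FG// Gg.
have mfg : measurable [set l : borel_rV R d | f l != g l].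
  rewrite (_ : [set _ | _] = (fun l : borel_rV R d => f l - g l) @^-1` [set~ 0]).
    have mB : measurable_fun setT (fun l : borel_rV R d => f l - g l) by exact: measurable_funB.
    by rewrite -[X in measurable X]setTI; apply: mB => //; exact: measurableC.
  by apply/seteqP; split => l /=; rewrite -subr_eq0 => /eqP.
apply/negligibleP => //; apply: negligibleS ae => l /= fg h.
by move: fg; have [->] := h Logic.I; rewrite eqxx.
Qed.

End spectral_density.

Theorem theorem3p4
  (R : realType) (d : nat) (d_ge1 : (1 <= d)%N)
  (dO : measure_display) (Omega : measurableType dO)
  (xi : Omega -> 'rV[R]_d -> R)
  (mxi : measurable_fun [set: Omega] (xi : Omega -> field_space R d))
  (P1 P2 : probability Omega R)
  (gauss1 : gaussian_field P1 xi) (gauss2 : gaussian_field P2 xi)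
  (mean1 : mean_zero P1 xi) (mean2 : mean_zero P2 xi)
  (k1 k2 : 'rV[R]_d -> R)
  (stat1 : stationary_with P1 xi k1) (stat2 : stationary_with P2 xi k2)
  (F1 F2 : {finite_measure set (borel_rV R d) -> \bar R})
  (spec1 : is_spectral_measure (covariance_fun P1 xi) F1)
  (spec2 : is_spectral_measure (covariance_fun P2 xi) F2)
  (ac1 : F1 `<< @lebesgue_rV R d) (ac2 : F2 `<< @lebesgue_rV R d)
  (f1 f2 : borel_rV R d -> R)
  (dens1 : is_density F1 f1) (dens2 : is_density F2 f2)
  (iso1 : isotropic k1) (iso2 : isotropic k2)
  (bnd1 : exists M : R, forall l, `|f1 l| <= M)
  (bnd2 : exists M : R, forall l, `|f2 l| <= M)
  (neq12 : (0 < @lebesgue_rV R d [set l | f1 l != f2 l])%E)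
  (uc1 : unif_continuous
           (fun p : 'rV[R]_d * 'rV[R]_d => covariance_fun P1 xi p.1 p.2))
  (uc2 : unif_continuous
           (fun p : 'rV[R]_d * 'rV[R]_d => covariance_fun P2 xi p.1 p.2))
  (T : set R) (itvT : is_interval T) (t0 : R) (Tt0 : T t0)
  (dX : measure_display) (OmegaX : measurableType dX)
  (PX : probability OmegaX R) (PX_complete : measure_is_complete PX)
  (X : R -> OmegaX -> 'rV[R]_d)
  (mX : forall t, T t ->
          measurable_fun [set: OmegaX] (X t : OmegaX -> borel_rV R d))
  (contX : forall w, {within T, continuous (fun t => X t w)})
  (X_t0 : forall w, X t0 w = 0)
  (X_unbounded : {ae PX, forall w, ~ bounded_set [set X t w | t in T]}) :
  let E := [set w | orthogonal_on (sigma_field xi [set X t w | t in T]) P1 P2] in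
  measurable E /\ PX E = 1%E.
Proof.
have rep1 := spectral_cos spec1.1; have rep2 := spectral_cos spec2.1.
have kE1 z : k1 z = \int[F1]_l cos (dotv l z) by rewrite -[z in LHS]subr0 -stat1 rep1 subr0.
have kE2 z : k2 z = \int[F2]_l cos (dotv l z) by rewrite -[z in LHS]subr0 -stat2 rep2 subr0.
have van1 : vanishes_at_infinity k1.
  move=> e e0; have [M f1M] := bnd1.
  have [K KP] := riemann_lebesgue_cos (bounded_density_le dens1 f1M) e0.
  by exists K => x Kx; rewrite kE1; exact: KP.
have van2 : vanishes_at_infinity k2.
  move=> e e0; have [M f2M] := bnd2.
  have [K KP] := riemann_lebesgue_cos (bounded_density_le dens2 f2M) e0.
  by exists K => x Kx; rewrite kE2; exact: KP.
(* If the sums agreed for all z, then z = 0 would give [k1 0 = k2 0], hence [k1 = k2]. The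
   uniqueness clause of [is_spectral_measure] would then identify [F1] with [F2], and the densities
   would agree almost everywhere. *)
have [z zP] : exists z, k1 0 + k1 z != k2 0 + k2 z.
  apply: contrapT => h.
  have kk z : k1 0 + k1 z = k2 0 + k2 z.
    by apply/eqP; apply: contrapT => /negP ?; apply: h; exists z.
  have k0 : k1 0 = k2 0 by have := kk 0; lra.
  have cc : covariance_fun P1 xi = covariance_fun P2 xi.
    apply/funext => x; apply/funext => y; rewrite stat1 stat2.
    by have := kk (x - y); rewrite k0 => /addrI.
  have F12 : forall A, measurable A -> F1 A = F2 A.
    by apply: spec2.2; rewrite -cc; exact: spec1.1.
  by move: neq12; rewrite (density_unique dens1 dens2 F12) ltxx.
move=> E.
(* Orthogonality is proved for each path with unbounded range, so the complement of [E] lies in a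
   negligible set; measurability of [E] itself then comes from completeness of [PX]. *)
have subE : ~` E `<=` ~` [set w | ~ bounded_set [set X t w | t in T]].
  apply: subsetC => w /= unb.
  apply: (@orthogonal_of_far_pairs _ _ _ _ P1 P2 xi mxi gauss1 gauss2 mean1 mean2
    k1 k2 stat1 stat2 iso1 iso2 van1 van2 _ z zP).
  move=> K.
  exact: (curve_far_pairs itvT Tt0 (X_t0 w) (contX w) unb).
have negE : PX.-negligible (~` E) by exact: negligibleS subE X_unbounded.
have mEC : measurable (~` E) by exact: PX_complete.
have mE : measurable E by rewrite -[E]setCK; exact: measurableC.
split => //.
have := probability_setC PX mE; rewrite ((negligibleP _ mEC).1 negE) => /esym/eqP.
by rewrite sube_eq ?add0e// => /eqP <-.
Qed.
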